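(* There exists a constant $\beta_1>0$, depending only on $J$ and $\Omega=(-1,1)$ (the constants $C_{J,1},C_{J,2}$ being fixed), such that for every $w_0\in L^2(-1,1)$ there is a constant $C$, depending on $w_0$, for which the solution $w=(u,v)$ of the coupled local/nonlocal problem $$\begin{cases}\dfrac{\partial u}{\partial t}(x,t)=\dfrac{\partial^2 u}{\partial x^2}(x,t), & x\in(-1,0),\ t>0,\\[4pt] \dfrac{\partial u}{\partial x}(-1,t)=0, & t>0,\\[4pt] \dfrac{\partial u}{\partial x}(0,t)=C_{J,2}\displaystyle\int_{-1}^0\int_0^1 J(x-y)\,(v(y,t)-u(0,t))\,dy\,dx, & t>0,\\[4pt] \dfrac{\partial v}{\partial t}(x,t)=C_{J,1}\displaystyle\int_0^1 J(x-y)(v(y,t)-v(x,t))\,dy-C_{J,2}\int_{-1}^0 J(x-y)\,dy\,(v(x,t)-u(0,t)), & x\in(0,1),\ t>0,\end{cases}$$ with initial condition $w(\cdot,0)=w_0$ satisfies $$\Big\|w(\cdot,t)-\frac12\int_{-1}^1w_0(x)\,dx\Big\|_{L^2(-1,1)}\le C e^{-\beta_1t}\qquad\text{for all }t>0.$$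
   Context: The kernel $J:\mathbb R\to[0,\infty)$ is continuous, symmetric ($J(-z)=J(z)$), compactly supported with $\mathrm{supp}(J)=[-R,R]$ for some $R>0$, and $\int_{\mathbb R}J(z)\,dz=1$. $C_{J,1},C_{J,2}>0$ are fixed constants. A function $w\in L^2(-1,1)$ is identified with the pair $(u,v)$, where $u=w|_{(-1,0)}$ and $v=w|_{(0,1)}$. For $u\in H^1(-1,0)$, $u(0)$ denotes the value at $0$ of its continuous representative on $[-1,0]$. ''Solution'' means mild solution: let $B$ be the operator in $L^2(-1,1)$ with domain $$D(B)=\Big\{(u,v): u\in H^2(-1,0),\ v\in L^2(0,1),\ u'(-1)=0,\ u'(0)=C_{J,2}\int_{-1}^0\int_0^1J(x-y)(v(y)-u(0))\,dy\,dx\Big\},$$ given by $B(u,v)(x)=-u''(x)$ for $x\in(-1,0)$ and $B(u,v)(x)=-C_{J,1}\int_0^1J(x-y)(v(y)-v(x))\,dy+C_{J,2}\int_{-1}^0J(x-y)\,dy\,(v(x)-u(0))$ for $x\in(0,1)$. The solution with initial datum $w_0$ is the function $w\in C([0,\infty);L^2(-1,1))$ with $w(0)=w_0$ that is the mild solution of $w'(t)+Bw(t)=0$ in the usual sense of accretive operators: for every $T>0$ and $\delta>0$ there are $0=t_0<t_1<\dots<t_N=T$ with $t_i-t_{i-1}\le\delta$, and $w_{(0)}\in L^2(-1,1)$, $w_{(1)},\dots,w_{(N)}\in D(B)$, such that $\frac{w_{(i)}-w_{(i-1)}}{t_i-t_{i-1}}+Bw_{(i)}=0$ for $i=1,\dots,N$,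 $\|w_{(0)}-w_0\|_{L^2}\le\delta$, and $\|w(t)-w_{(i)}\|_{L^2}\le\delta$ for $t\in(t_{i-1},t_i]$. (Such a solution exists and is unique for each $w_0\in L^2(-1,1)$.) *)

(* Defs.v *)
From HB Require Import structures.
From mathcomp Require Import all_boot all_order all_algebra.
From mathcomp Require Import all_classical all_reals all_analysis.

Set Implicit Arguments.
Unset Strict Implicit.
Unset Printing Implicit Defensive.
Import Order.TTheory GRing.Theory Num.Theory.
Import numFieldNormedType.Exports.

Local Open Scope classical_set_scope.
Local Open Scope ring_scope.

Notation leb := lebesgue_measure.

(* An element of L^2(a,b) is represented by a function on R of which only the
   values on ]a, b[ matter: it is cut off to 0 outside before the library's
   L^2 notions are applied, and equality in L^2 is equality a.e. on ]a, b[. *)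
Definition L2 (R : realType) (a b : R) (f : R -> R) : Prop :=
  f \_ `]a, b[ \in Lfun (@leb R) 2%:E.

Definition L2norm (R : realType) (a b : R) (f : R -> R) : \bar R :=
  'N[@leb R]_2%:E[EFin \o (f \_ `]a, b[)]%E.

Definition test_function (R : realType) (a b : R) (phi : R -> R) : Prop :=
  [/\ forall x : R, derivable phi x 1,
      continuous (derive1 phi),
      compact (closure [set x | phi x != 0])
    & closure [set x | phi x != 0] `<=` `]a, b[].

(* H^1(a,b) and H^2(a,b) as in Brezis, "Functional Analysis, Sobolev Spaces and
   PDE", chapter 8: the test functions are those of class C^1 with compact
   support in ]a, b[, and H^2(a,b) consists of the u in H^1(a,b) such that u'
   belongs to H^1(a,b). *)
Definition weak_derivative (R : realType) (a b : R) (f g : R -> R) : Prop :=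
  forall phi : R -> R, test_function a b phi ->
    \int[@leb R]_(x in `]a, b[) (f x * derive1 phi x) =
    - \int[@leb R]_(x in `]a, b[) (g x * phi x).

Definition H1 (R : realType) (a b : R) (f : R -> R) : Prop :=
  L2 a b f /\ exists g : R -> R, L2 a b g /\ weak_derivative a b f g.

(* Chosen arbitrarily within its a.e. class; meaningful when [H1 a b f]. *)
Definition wderiv (R : realType) (a b : R) (f : R -> R) : R -> R :=
  get [set g : R -> R | L2 a b g /\ weak_derivative a b f g].

Definition H2 (R : realType) (a b : R) (f : R -> R) : Prop :=
  H1 a b f /\ H1 a b (wderiv a b f).

(* Unique on `[a, b]; meaningful when [H1 a b f]. *)
Definition cont_repr (R : realType) (a b : R) (f : R -> R) : R -> R :=
  get [set g : R -> R | {within `[a, b], continuous g} /\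
                        f = g %[ae @leb R in `]a, b[%classic]].

Definition admissible_kernel (R : realType) (J : R -> R) : Prop :=
  [/\ continuous J,
      forall z : R, 0 <= J z,
      forall z : R, J (- z) = J z,
      exists2 r : R, 0 < r & closure [set z | J z != 0] = `[- r, r]%classic
    & (\int[@leb R]_z (J z)%:E = 1)%E].

(* A pair (u, v) is the single function w with u = w on ]-1, 0[ and v = w on
   ]0, 1[. *)
Definition u_at0 (R : realType) (w : R -> R) : R := cont_repr (-1) 0 w 0.

Definition domB (R : realType) (J : R -> R) (C2 : R) (w : R -> R) : Prop :=
  [/\ H2 (-1) 0 w,
      L2 0 1 w,
      cont_repr (-1) 0 (wderiv (-1) 0 w) (-1) = 0
    & cont_repr (-1) 0 (wderiv (-1) 0 w) 0 =
      C2 * \int[@leb R]_(x in `]-1, 0[)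
             (\int[@leb R]_(y in `]0, 1[) (J (x - y) * (w y - u_at0 w)))].

Definition opB (R : realType) (J : R -> R) (C1 C2 : R) (w : R -> R) (x : R)
    : R :=
  if x < 0 then - wderiv (-1) 0 (wderiv (-1) 0 w) x
  else - C1 * \int[@leb R]_(y in `]0, 1[) (J (x - y) * (w y - w x))
       + C2 * (\int[@leb R]_(y in `]-1, 0[) J (x - y)) * (w x - u_at0 w).

(* [t] and [z] are sequences of which only the terms 0, ..., N are used. *)
Definition euler_approximation (R : realType) (J : R -> R) (C1 C2 : R)
    (w0 : R -> R) (w : R -> R -> R) (T delta : R)
    (N : nat) (t : nat -> R) (z : nat -> R -> R) : Prop :=
  [/\ t 0%N = 0 /\ t N = T,
      forall i, (i < N)%N -> t i < t i.+1 /\ t i.+1 - t i <= delta,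
      L2 (-1) 1 (z 0%N) /\
        (L2norm (-1) 1 (fun x => z 0%N x - w0 x)%R <= delta%:E)%E,
      forall i, (i < N)%N -> domB J C2 (z i.+1) /\
        (fun x => (z i.+1 x - z i x) / (t i.+1 - t i)
                  + opB J C1 C2 (z i.+1) x)
          = (fun=> 0) %[ae @leb R in `]-1, 1[%classic]
    & forall (i : nat) (s : R), (i < N)%N -> t i < s <= t i.+1 ->
        (L2norm (-1) 1 (fun x => w s x - z i.+1 x)%R <= delta%:E)%E].

(* [w t] is the state at time [t]; only times [t >= 0] matter. *)
Definition mild_solution (R : realType) (J : R -> R) (C1 C2 : R)
    (w0 : R -> R) (w : R -> R -> R) : Prop :=
  [/\ forall t : R, 0 <= t -> L2 (-1) 1 (w t),
      forall t : R, 0 <= t ->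
        L2norm (-1) 1 (fun x => w s x - w t x)
          @[s --> within [set s | 0 <= s] (nbhs t)] --> 0%E,
      w 0 = w0 %[ae @leb R in `]-1, 1[%classic]
    & forall T delta : R, 0 < T -> 0 < delta -> exists N t z,
        euler_approximation J C1 C2 w0 w T delta N t z].

(* Main.v *)
Require Import Defs.
From HB Require Import structures.
From mathcomp Require Import all_boot all_order all_algebra.
From mathcomp Require Import all_classical all_reals all_analysis.
From mathcomp Require Import measurable_realfun ring lra.
Import Order.TTheory GRing.Theory Num.Theory.
Import numFieldNormedType.Exports.
Local Open Scope classical_set_scope.
Local Open Scope ring_scope.

Set Implicit Arguments.
Unset Strict Implicit.
Unset Printing Implicit Defensive.

(** The constants span the kernel of B, the mean over ]-1, 1[ is conserved, and
on functions of mean zero B is bounded below by a positive constant beta; the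
rest is the standard passage from such a bound to exponential decay.

Dissipation. Let w = (u, v) be in D(B), u0 = u(0) and q = w - u0. Integrating
by parts on ]-1, 0[, using the symmetry of J on ]0, 1[ and the flux condition
at 0, one finds that B w has integral 0 and that
[[
  int (B w) q = int_(-1)^0 u'^2
              + C1 / 2 * iint_(]0, 1[^2) J(x - y) (v(y) - v(x))^2
              + C2 * int_0^1 Kc(x) q(x)^2,   Kc(x) = int_(-1)^0 J(x - y) dy
]]
(local_mean, local_dissipation, nonlocal_mean, nonlocal_dissipation). Shifting
by u0 instead of by the mean makes the two sides of the interface decouple.
The right-hand side controls int q^2. On ]-1, 0[ this is the Poincare
inequality for a function that vanishes at 0 (trace_poincare). On ]0, 1[ the
weight Kc is in general bounded below only near the interface, and J may vanish
at 0 and at many other points; but J >= c on some interval ]l, l + 2d[ inside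
]0, 1[, and interactions at distance between l and l + d carry the control of q from the
left to the right (nonlocal_coercive). Since the mean is the constant nearest
to w, int q^2 is at least int (w - mean w)^2.

Decay. An implicit Euler step of length h thus keeps the mean and divides the
distance to it by at least 1 + beta h (euler_step_contraction). Multiplying
over the steps up to time t and using (1 + beta h)^2 >= exp(beta h) for small h
gives the factor exp(-beta t / 2) (euler_decay), and the mesh tends to 0.

Regularity. The computation needs u and u' to be primitives of their weak
derivatives. If g is a weak derivative of f, then testing against a smooth
approximation of the indicator of ]x, y[ and shrinking the transition zones
gives f(y) - f(x) = int_x^y g at all Lebesgue points x < y of f
(weak_derivative_increment), hence almost everywhere. Integration by parts is
then an exchange of the order of integration (Dirichlet_energy), and so is the
symmetrization of the nonlocal terms (nonlocal_energy): both are instances of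
kernel_swap. *)

(** * Integrable and square integrable functions on a set *)

Notation intg D f := ((@leb _).-integrable D (EFin \o f)).

(** The [L2] of the statement without its cut-off, so that the elements of
L^2(-1, 0), L^2(0, 1) and L^2(-1, 1) can be restricted and glued. *)
Definition sqi (R : realType) (D : set R) (f : R -> R) : Prop :=
  measurable_fun D f /\ intg D (fun x => f x ^+ 2).

Section integrability.
Variables (R : realType) (D : set R).
Hypothesis mD : @measurable _ (measurableTypeR R) D.
Implicit Types f g : R -> R.
Local Notation mu := (@leb R).

Lemma intg_meas f : intg D f -> measurable_fun D f.
Proof. by move/integrableP => [/measurable_EFinP]. Qed.

Lemma eq_intg f g : {in D, f =1 g} -> intg D f -> intg D g.
Proof. by move=> fg; apply: eq_integrable => // x xD /=; rewrite fg. Qed.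

Lemma intgD f g : intg D f -> intg D g -> intg D (fun x => f x + g x).
Proof.
move=> If Ig; apply: (eq_integrable mD _ _ _ (integrableD mD If Ig)).
by move=> x _ /=; rewrite EFinD.
Qed.

Lemma intgB f g : intg D f -> intg D g -> intg D (fun x => f x - g x).
Proof.
move=> If Ig; apply: (eq_integrable mD _ _ _ (integrableB mD If Ig)).
by move=> x _ /=; rewrite EFinB.
Qed.

Lemma intgZ c f : intg D f -> intg D (fun x => c * f x).
Proof.
move=> If; apply: (eq_integrable mD _ _ _ (integrableZl mD c If)).
by move=> x _ /=; rewrite EFinM.
Qed.

Lemma le_intg f g : measurable_fun D f -> (forall x, D x -> `|f x| <= g x) ->
  intg D g -> intg D f.
Proof.
move=> mf fg; apply: le_integrable => //; first exact/measurable_EFinP.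
by move=> x Dx /=; rewrite lee_fin (le_trans (fg _ Dx))// ler_norm.
Qed.

Lemma intg_bdM (h f : R -> R) c : measurable_fun D h -> (forall x, D x -> `|h x| <= c) ->
  intg D f -> intg D (fun x => h x * f x).
Proof.
move=> mh hc If; apply: (@le_intg _ (fun x => c * `|f x|)).
- by apply: measurable_funM => //; exact: intg_meas.
- by move=> x Dx; rewrite normrM ler_wpM2r// hc.
- by apply: intgZ; exact: integrable_norm.
Qed.

Lemma intgS (E : set R) f : measurable E -> E `<=` D -> intg D f -> intg E f.
Proof. by move=> mE ED; exact: integrableS. Qed.

Lemma sqi_mul f g : sqi D f -> sqi D g -> intg D (fun x => f x * g x).
Proof.
move=> [mf If] [mg Ig]; apply: (@le_intg _ (fun x => f x ^+ 2 + g x ^+ 2)).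
- exact: measurable_funM.
- by move=> x Dx; rewrite ler_norml; apply/andP; split; nra.
- exact: intgD.
Qed.

Lemma sqiD f g : sqi D f -> sqi D g -> sqi D (fun x => f x + g x).
Proof.
move=> sf sg; split; first by apply: measurable_funD; [case: sf|case: sg].
apply: (@eq_intg (fun x => f x ^+ 2 + (2 * (f x * g x) + g x ^+ 2))).
  by move=> x _; ring.
apply: intgD; first by case: sf.
by apply: intgD; [apply: intgZ; exact: sqi_mul|case: sg].
Qed.

Lemma sqiZ c f : sqi D f -> sqi D (fun x => c * f x).
Proof.
move=> [mf If]; split; first by apply: measurable_funM => //.
apply: (@eq_intg (fun x => c ^+ 2 * f x ^+ 2)); first by move=> x _; ring.
exact: intgZ.
Qed.

Lemma eq_sqi f g : {in D, f =1 g} -> sqi D f -> sqi D g.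
Proof.
move=> fg [mf If]; split; first exact: eq_measurable_fun mf.
by apply: eq_intg If => x xD; rewrite fg.
Qed.

Lemma sqiB f g : sqi D f -> sqi D g -> sqi D (fun x => f x - g x).
Proof.
move=> sf sg; apply: (@eq_sqi (fun x => f x + (-1) * g x)).
  by move=> x _; ring.
by apply: sqiD => //; exact: sqiZ.
Qed.

Hypothesis fD : (mu D < +oo)%E.

Lemma intg_cst c : intg D (fun=> c).
Proof.
apply: measurable_bounded_integrable => //.
by exists `|c|; split => // M cM x _ /=; exact: ltW.
Qed.

Lemma sqi_cst c : sqi D (fun=> c).
Proof. by split => //; exact: intg_cst. Qed.

Lemma sqi_intg f : sqi D f -> intg D f.
Proof.
move=> sf; apply: (@eq_intg (fun x => f x * 1)); first by move=> x _; ring.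
by apply: sqi_mul => //; exact: sqi_cst.
Qed.

Lemma intg_bounded (f : R -> R) c : measurable_fun D f -> (forall x, D x -> `|f x| <= c) ->
  intg D f.
Proof. by move=> mf fc; apply: (le_intg mf fc); exact: intg_cst. Qed.

End integrability.

Section itv.
Variable R : realType.
Implicit Types (a b : R) (f g : R -> R).
Local Notation mu := (@leb R).

(** The sigma-algebra here is the one on which [lebesgue_measure] is defined;
it is convertible, but not syntactically equal, to the one of [R]. *)
Lemma measurable_oo a b : @measurable _ (measurableTypeR R) `]a, b[%classic.
Proof. exact: measurable_itv. Qed.

Lemma mu_itv a b : a <= b -> mu `]a, b[ = (b - a)%:E.
Proof.
rewrite le_eqVlt => /orP[/eqP ->|ab]; rewrite lebesgue_measure_itv/= lte_fin.
  by rewrite ltxx subrr.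
by rewrite ab EFinB.
Qed.

Lemma mu_itv_lty a b : (mu `]a, b[ < +oo)%E.
Proof.
rewrite lebesgue_measure_itv/=; case: ifP => // _; exact: ltry.
Qed.

Lemma Rintegral_itv_cst a b c : a <= b -> \int[mu]_(x in `]a, b[) c = c * (b - a).
Proof.
move=> ab; transitivity (c * fine (mu `]a, b[)); last by rewrite mu_itv.
exact: Rintegral_cst.
Qed.

Lemma L2P a b f : L2 a b f <-> sqi `]a, b[ f.
Proof.
have mI := measurable_oo a b.
rewrite /L2 inE /sqi; split.
  move=> fl; have := Lfun2_integrable_sqr fl.
  move: fl => /andP[]; rewrite inE/= => mf _ If; split.
    exact/(measurable_restrictT _ mI).
  apply/(integrable_mkcond _ mI).
  apply: (eq_integrable _ _ _ _ If) => // x _; rewrite restrict_EFin/= !patchE.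
  by case: ifP => //; rewrite expr0n.
move=> [mf If]; have mfr : measurable_fun setT (f \_ `]a, b[).
  exact/(measurable_restrictT _ mI).
apply/andP; split; rewrite inE//=.
rewrite /finite_norm unlock poweR_lty//.
move/(integrable_mkcond _ mI) : If => /integrableP[_].
apply: le_lt_trans; rewrite le_eqVlt; apply/orP; left; apply/eqP.
apply: eq_integral => x _; rewrite restrict_EFin/= !patchE.
case: ifP => _ /=.
  by rewrite powR_mulrn// real_normK ?num_real// ger0_norm ?sqr_ge0.
by rewrite !normr0 powR0.
Qed.

Lemma L2normE a b f : sqi `]a, b[ f ->
  L2norm a b f = (Num.sqrt (\int[mu]_(x in `]a, b[) f x ^+ 2))%:E.
Proof.
move=> [mf If]; have mI := measurable_oo a b.
rewrite /L2norm unlock /=.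
rewrite (_ : (\int[_]_x _)%E = (\int[mu]_(x in `]a, b[) f x ^+ 2)%:E).
  by rewrite poweR_EFin powR12_sqrt// Rintegral_ge0// => x _; exact: sqr_ge0.
rewrite /Rintegral fineK; last exact: integrable_fin_num.
rewrite [RHS]integral_mkcond; apply: eq_integral => x _.
rewrite restrict_EFin/= !patchE; case: ifP => _ /=.
  by rewrite powR_mulrn// real_normK ?num_real.
by rewrite !normr0 powR0.
Qed.

End itv.

(** * Fubini for bounded kernels *)

(** All double integrals below have the shape f(x) K(x, y) g(y) with K bounded
and f, g integrable, for which absolute convergence comes for free. *)
Section swap.
Variables (R : realType) (A B : set R).
Local Notation mu := (@leb R).
Hypothesis mA : @measurable _ (measurableTypeR R) A.
Hypothesis mB : @measurable _ (measurableTypeR R) B.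
Implicit Types f g : R -> R.

Lemma integral_restrict_mul (D : set R) (k g : R -> R) (c : R) :
  @measurable _ (measurableTypeR R) D -> intg D (fun y => k y * g y) ->
  (\int[mu]_y (k y * c * (g \_ D) y)%:E)%E =
  (c * \int[mu]_(y in D) (k y * g y))%:E.
Proof.
move=> mD Ikg; rewrite -RintegralZl// /Rintegral fineK; last first.
  by apply: integrable_fin_num => //; exact: intgZ.
rewrite [RHS]integral_mkcond; apply: eq_integral => y _.
rewrite restrict_EFin/= !patchE; case: ifP => _; last by rewrite mulr0.
by congr EFin; ring.
Qed.

Variables (K : R * R -> R) (M : R).
Hypothesis mK : measurable_fun setT K.
Hypothesis hK : forall z, `|K z| <= M.

Lemma intg_section1 g (x : R) : intg B g -> intg B (fun y => K (x, y) * g y).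
Proof.
move=> Ig; apply: (@intg_bdM _ _ mB _ _ M) => //.
by apply: measurable_funTS; exact: (measurableT_comp mK (pair1_measurable x)).
Qed.

Lemma intg_section2 f (y : R) : intg A f -> intg A (fun x => K (x, y) * f x).
Proof.
move=> If; apply: (@intg_bdM _ _ mA _ _ M) => //.
by apply: measurable_funTS; exact: (measurableT_comp mK (pair2_measurable y)).
Qed.

Variables (f g : R -> R).
Hypotheses (If : intg A f) (Ig : intg B g).

Let H (z : measurableTypeR R * measurableTypeR R) : \bar R := (K z * (f \_ A) z.1 * (g \_ B) z.2)%:E.

Let mH : measurable_fun setT H.
Proof.
apply/measurable_EFinP; apply: measurable_funM; last first.
  apply: (measurableT_comp _ measurable_snd).
  by apply/(measurable_restrictT _ mB); exact: intg_meas.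
apply: measurable_funM => //; apply: (measurableT_comp _ measurable_fst).
by apply/(measurable_restrictT _ mA); exact: intg_meas.
Qed.

Let intH : ((@leb R) \x (@leb R))%E.-integrable setT H.
Proof.
apply/(integrable12ltyP (@leb R) (@leb R) mH).
have IA : intg setT (fun x => `|(f \_ A) x|).
  apply: integrable_norm; move/(integrable_mkcond _ mA) : If.
  by apply: eq_integrable => // x _; rewrite restrict_EFin.
have IB : intg setT (fun x => `|(g \_ B) x|).
  apply: integrable_norm; move/(integrable_mkcond _ mB) : Ig.
  by apply: eq_integrable => // x _; rewrite restrict_EFin.
have IA' := integrableZl measurableT (M * \int[mu]_y `|(g \_ B) y|) IA.
apply: le_lt_trans (integrable_lty measurableT IA').
apply: ge0_le_integral => //.
- by move=> x _; exact: integral_ge0.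
- apply: (measurable_fun_fubini_tonelli_F (abse \o H)) => //=.
  exact: measurableT_comp.
- exact: measurable_int IA'.
move=> x _; rewrite /= -EFinM mulrAC EFinM.
have -> : (\int[mu]_y `|(g \_ B) y|)%:E = (\int[mu]_y (`|(g \_ B) y|)%:E)%E.
  by rewrite /Rintegral fineK//; exact: integrable_fin_num IB.
rewrite -integralZl//; apply: ge0_le_integral => //.
- have mHx : @measurable_fun _ _ (measurableTypeR R) _ setT (fun y => H (x, y)).
    exact: (measurableT_comp mH (pair1_measurable x)).
  exact/measurable_EFinP/measurableT_comp/measurable_EFinP.
- exact: (measurable_int _ (integrableZl measurableT _ IB)).
- move=> y _; rewrite lee_fin !normrM /=.
  by rewrite ler_wpM2r// ler_wpM2r.
Qed.

Let FE x : (\int[mu]_y H (x, y))%E =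
  (((fun x => f x * \int[mu]_(y in B) (K (x, y) * g y)) \_ A) x)%:E.
Proof.
have := @integral_restrict_mul B (fun y => K (x, y)) g ((f \_ A) x) mB.
move=> /(_ (intg_section1 x Ig)) /= ->.
by congr EFin; rewrite !patchE; case: ifP => // _; rewrite mul0r.
Qed.

Let GE y : (\int[mu]_x H (x, y))%E =
  (((fun y => g y * \int[mu]_(x in A) (K (x, y) * f x)) \_ B) y)%:E.
Proof.
rewrite /H /=; under eq_integral do rewrite mulrAC.
have := @integral_restrict_mul A (fun x => K (x, y)) f ((g \_ B) y) mA.
move=> /(_ (intg_section2 y If)) /= ->.
by congr EFin; rewrite !patchE; case: ifP => // _; rewrite mul0r.
Qed.

Lemma intg_kernel1 : intg A (fun x => f x * \int[mu]_(y in B) (K (x, y) * g y)).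
Proof.
apply/(integrable_mkcond _ mA); rewrite restrict_EFin.
by apply: (eq_integrable _ _ _ _ (integrable_fubini_F intH)) => // x _; exact: FE.
Qed.

(** The workhorse: it symmetrizes the nonlocal terms, matches the flux through
the interface seen from both sides, and, for K the indicator of x < y, is
integration by parts. *)
Lemma kernel_swap :
  \int[mu]_(x in A) (f x * \int[mu]_(y in B) (K (x, y) * g y)) =
  \int[mu]_(y in B) (g y * \int[mu]_(x in A) (K (x, y) * f x)).
Proof.
have := Fubini intH; under eq_integral do rewrite FE.
under [X in _ = X -> _]eq_integral do rewrite GE.
move=> e; rewrite [LHS]Rintegral_mkcond [RHS]Rintegral_mkcond /Rintegral.
exact: (congr1 fine e).
Qed.

End swap.

(** * Nonlocal diffusion as a quadratic form *)

Section nonlocal_form.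
Variables (R : realType) (D : set R).
Local Notation mu := (@leb R).
Hypothesis mD : @measurable _ (measurableTypeR R) D.
Hypothesis fD : (mu D < +oo)%E.
Variables (J : R -> R) (M : R).
Hypothesis mJ : measurable_fun setT J.
Hypothesis JM : forall z, `|J z| <= M.

Let K (z : R * R) : R := J (z.1 - z.2).

Lemma measurable_diff_kernel : measurable_fun setT K.
Proof. by apply: (measurableT_comp mJ); exact: measurable_funB. Qed.

Let mK := measurable_diff_kernel.
Let hK z : `|K z| <= M. Proof. exact: JM. Qed.

Variable q : R -> R.
Hypothesis sq : sqi D q.
Hypothesis Jsym : forall z, J (- z) = J z.

Let A0 x := \int[mu]_(y in D) (K (x, y) * 1).
Let A1 x := \int[mu]_(y in D) (K (x, y) * q y).
Let A2 x := \int[mu]_(y in D) (K (x, y) * q y ^+ 2).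

Let I1 : intg D (fun=> 1). Proof. exact: intg_cst. Qed.
Let Iq : intg D q. Proof. exact: sqi_intg. Qed.
Let Iq2 : intg D (fun x => q x ^+ 2). Proof. by case: sq. Qed.

Let diffE x : \int[mu]_(y in D) (J (x - y) * (q y - q x)) = A1 x - q x * A0 x.
Proof.
have s0 := intg_section1 mD mK hK x I1.
rewrite /A0 -RintegralZl// /A1 -RintegralB//.
- by apply: eq_Rintegral => y _; rewrite /K /=; ring.
- exact: (intg_section1 mD mK hK x Iq).
- exact: intgZ.
Qed.

Let sqE x : \int[mu]_(y in D) (J (x - y) * (q y - q x) ^+ 2) =
  A2 x - 2 * (q x * A1 x) + q x ^+ 2 * A0 x.
Proof.
have s0 := intg_section1 mD mK hK x I1.
have s1 := intg_section1 mD mK hK x Iq.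
have s2 := intg_section1 mD mK hK x Iq2.
rewrite /A0 -[q x ^+ 2 * _]RintegralZl// mulrA /A1 -RintegralZl//.
rewrite /A2 -RintegralB//; last exact: intgZ.
rewrite -RintegralD//; [|by apply: intgB => //; exact: intgZ|exact: intgZ].
by apply: eq_Rintegral => y _; rewrite /K /=; ring.
Qed.

Let A0E x : \int[mu]_(y in D) (K (y, x) * 1) = A0 x.
Proof.
by apply: eq_Rintegral => y _; rewrite /K /= -Jsym opprB.
Qed.

Let swap1 : \int[mu]_(x in D) (1 * A1 x) = \int[mu]_(x in D) (q x * A0 x).
Proof.
rewrite /A1 (kernel_swap mD mD mK hK I1 Iq).
by apply: eq_Rintegral => y _; rewrite A0E.
Qed.

Let swap2 : \int[mu]_(x in D) (1 * A2 x) = \int[mu]_(x in D) (q x ^+ 2 * A0 x).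
Proof.
rewrite /A2 (kernel_swap mD mD mK hK I1 Iq2).
by apply: eq_Rintegral => y _; rewrite A0E.
Qed.

Let i10 : intg D (fun x => q x * A0 x).
Proof. exact: (intg_kernel1 mD mD mK hK Iq I1). Qed.
Let i20 : intg D (fun x => q x ^+ 2 * A0 x).
Proof. exact: (intg_kernel1 mD mD mK hK Iq2 I1). Qed.
Let i01 : intg D (fun x => 1 * A1 x).
Proof. exact: (intg_kernel1 mD mD mK hK I1 Iq). Qed.
Let i11 : intg D (fun x => q x * A1 x).
Proof. exact: (intg_kernel1 mD mD mK hK Iq Iq). Qed.
Let i02 : intg D (fun x => 1 * A2 x).
Proof. exact: (intg_kernel1 mD mD mK hK I1 Iq2). Qed.

Lemma intg_nonlocal :
  intg D (fun x => \int[mu]_(y in D) (J (x - y) * (q y - q x))).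
Proof.
apply: (eq_intg mD _ (intgB mD i01 i10)) => x _.
by rewrite diffE mul1r.
Qed.

Lemma intg_mul_nonlocal :
  intg D (fun x => q x * \int[mu]_(y in D) (J (x - y) * (q y - q x))).
Proof.
apply: (eq_intg mD _ (intgB mD i11 i20)) => x _.
by rewrite diffE; ring.
Qed.

Lemma intg_energy_density :
  intg D (fun x => \int[mu]_(y in D) (J (x - y) * (q y - q x) ^+ 2)).
Proof.
apply: (eq_intg mD _ (intgD mD (intgB mD i02 (intgZ mD 2 i11)) i20)) => x _.
by rewrite sqE mul1r.
Qed.

(** The integrand is antisymmetric in x and y. *)
Lemma nonlocal_mean0 :
  \int[mu]_(x in D) \int[mu]_(y in D) (J (x - y) * (q y - q x)) = 0.
Proof.
under eq_Rintegral do rewrite diffE -[A1 _]mul1r.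
by rewrite (RintegralB mD i01 i10) swap1 subrr.
Qed.

(** Exchange x and y and take the half sum. The square is expanded into terms
that are separately integrable, so that only single integrals are added. *)
Lemma nonlocal_energy :
  \int[mu]_(x in D) (q x * \int[mu]_(y in D) (J (x - y) * (q y - q x))) =
  - 2^-1 * \int[mu]_(x in D) \int[mu]_(y in D) (J (x - y) * (q y - q x) ^+ 2).
Proof.
under eq_Rintegral do rewrite diffE mulrBr mulrA -expr2.
rewrite (RintegralB mD i11 i20).
under [in RHS]eq_Rintegral do rewrite sqE -[A2 _]mul1r.
rewrite (RintegralD mD (intgB mD i02 (intgZ mD 2 i11)) i20).
rewrite (RintegralB mD i02 (intgZ mD 2 i11)) (RintegralZl _ mD i11) swap2.
by move: (Rintegral _ _ _) (Rintegral _ _ _) => u v; field.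
Qed.

End nonlocal_form.

Section bounds.
Variable R : realType.
Local Notation mu := (@leb R).

Lemma itv_oo_sub (a b u v : R) : a <= u -> v <= b -> `]u, v[ `<=` `]a, b[.
Proof.
move=> au vb x /=; rewrite !in_itv /= => /andP[ux xv].
by rewrite (le_lt_trans au ux) (lt_le_trans xv vb).
Qed.

Lemma Rintegral_ge_itv (D : set R) (u v c : R) (F : R -> R) :
  @measurable _ (measurableTypeR R) D -> u <= v -> `]u, v[ `<=` D ->
  intg D F -> (forall x, D x -> 0 <= F x) ->
  (forall x, u < x < v -> c <= F x) -> c * (v - u) <= \int[mu]_(x in D) F x.
Proof.
move=> mD uv uvD IF F0 Fc.
have IF' := intgS mD (measurable_oo u v) uvD IF.
apply: (@le_trans _ _ (\int[mu]_(x in `]u, v[) F x)).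
  rewrite -Rintegral_itv_cst//; apply: (le_Rintegral (measurable_oo u v)) => //.
    by apply: (intg_cst (measurable_oo u v)); exact: mu_itv_lty.
rewrite /Rintegral; apply: fine_le.
- exact: (integrable_fin_num (measurable_oo u v) (f := EFin \o F) IF').
- exact: (integrable_fin_num mD (f := EFin \o F) IF).
apply: ge0_subset_integral => //.
  exact: measurable_int IF.
Qed.

Lemma Rintegral_indic_itv_le (D : set R) (u v : R) :
  @measurable _ (measurableTypeR R) D -> u <= v ->
  \int[mu]_(x in D) \1_`]u, v[ x <= v - u.
Proof.
move=> mD uv; rewrite /Rintegral integral_indic//.
rewrite -[leRHS]/(fine (v - u)%:E) -mu_itv//.
have le : (mu (`]u, v[ `&` D) <= mu `]u, v[)%E.
  by apply: le_measure; rewrite ?inE//; apply: measurableI.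
have uvfin : mu `]u, v[ \is a fin_num by rewrite mu_itv.
apply: fine_le => //.
by rewrite ge0_fin_numE//; exact: le_lt_trans le (mu_itv_lty u v).
Qed.

End bounds.

(** * Coercivity of nonlocal diffusion coupled to the interface *)

Section kernel_facts.
Variables (R : realType) (J : R -> R).
Hypothesis hJ : admissible_kernel J.

Lemma kernel_measurable : measurable_fun setT J.
Proof. by case: hJ => cJ _ _ _ _; exact: continuous_measurable_fun. Qed.

(** A continuous function with compact support is bounded. *)
Lemma kernel_bounded : exists M, forall z, `|J z| <= M.
Proof.
case: hJ => cJ _ _ [r r0 sJ] _.
have [M [_ hM]] : bounded_set (J @` `[- r, r]).
  apply: compact_bounded; apply: continuous_compact; last exact: segment_compact.
  exact: continuous_subspaceT.
exists (Num.max 0 (M + 1)) => z.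
have [->|Jz] := eqVneq (J z) 0; first by rewrite normr0 le_max lexx.
rewrite le_max; apply/orP; right; apply: hM; first by rewrite ltrDl.
exists z => //; rewrite -sJ; exact: subset_closure.
Qed.

(** As 0 < r, the midpoint of ]0, min(r, 1)[ lies in the support, so J is
positive somewhere in this interval, and hence bounded below nearby. Nothing
can be said of J at 0 itself. The interval is split in two halves later: the
first one serves to move to the right, the second one to reach ]-1, 0[. *)
Lemma kernel_pos_itv : exists l d c : R,
  [/\ 0 < l, 0 < d, l + 2 * d <= 1, 0 < c &
      forall z, l < z < l + 2 * d -> c <= J z].
Proof.
case: hJ => cJ J0 _ [r r0 sJ] _.
pose m := Num.min r 1 / 2.
have mr1 : 0 < Num.min r 1 by rewrite lt_min r0 ltr01.
have [mr m1] : Num.min r 1 <= r /\ Num.min r 1 <= 1.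
  by split; rewrite ge_min lexx ?orbT.
have m0 : 0 < m by rewrite divr_gt0.
have : closure [set z | J z != 0] m.
  by rewrite sJ /= in_itv /= /m; apply/andP; split; lra.
move=> /(_ (ball m m)) /(_ (nbhsx_ballx _ _ m0)) [z [/= Jz]].
rewrite /ball /= ltr_distl => /andP[z0 z1].
have {}Jz : 0 < J z by rewrite lt_neqAle eq_sym Jz J0.
have /cvgrPdist_lt/(_ (J z / 2)) := cJ z.
rewrite divr_gt0// => /(_ isT); rewrite near_nbhs => -[e /= e0 he].
pose d := Num.min e (Num.min z (1 - z)) / 4.
have z01 : 0 < Num.min z (1 - z).
  by rewrite lt_min; apply/andP; split; rewrite /m in z0 z1 *; lra.
have d0 : 0 < d by rewrite divr_gt0// lt_min e0 z01.
have de : 4 * d <= e by rewrite /d mulrC divfK// ge_min lexx.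
have dz : 4 * d <= z by rewrite /d mulrC divfK// !ge_min lexx !orbT.
have dz1 : 4 * d <= 1 - z by rewrite /d mulrC divfK// !ge_min lexx !orbT.
exists (z - d), d, (J z / 2); split => //; [lra|lra|exact: divr_gt0|].
move=> y /andP[y0 y1].
have : `|J z - J y| < J z / 2.
  by apply: he => /=; rewrite ltr_distl; apply/andP; split; lra.
rewrite ltr_distl => /andP[_ h]; lra.
Qed.

End kernel_facts.

(** On ]0, 1[, q(x)^2 is compared with its values at distance between l and
l + d to the left of x: with [kap] the indicator of l < x - y < l + d,
kap q(x)^2 <= 2 kap (q(y) - q(x))^2 + 2 kap q(y)^2, and the first term is
bounded by the energy. The second one would have to be absorbed; iterating from
the interface to 1 would do, but the exponential weight [rho], which loses at
least a factor 4 over the distance l, absorbs it in one go. Points x < l + d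
may lack such neighbours inside ]0, 1[; there Kc >= c d, because the second half
of the interval where J >= c lies across the interface. *)
Section coercivity.
Variables (R : realType) (J : R -> R) (M l d c : R).
Local Notation mu := (@leb R).
Hypotheses (l0 : 0 < l) (d0 : 0 < d) (ld1 : l + 2 * d <= 1) (c0 : 0 < c).
Hypothesis Jc : forall z, l < z < l + 2 * d -> c <= J z.
Hypothesis J0 : forall z, 0 <= J z.
Hypothesis mJ : measurable_fun setT J.
Hypothesis JM : forall z, `|J z| <= M.
Variable q : R -> R.
Hypothesis sq : sqi `]0, 1[ q.

Let K (z : R * R) : R := J (z.1 - z.2).
Let mK : measurable_fun setT K.
Proof. exact: measurable_diff_kernel. Qed.
Let hK z : `|K z| <= M. Proof. exact: JM. Qed.

Let kap (z : R * R) : R := \1_`]l, (l + d)[ (z.1 - z.2).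

Let mkap : measurable_fun setT kap.
Proof.
apply: (@measurable_diff_kernel _ (\1_`]l, (l + d)[)).
by apply: measurable_indic.
Qed.

Let kap0 z : 0 <= kap z.
Proof. by rewrite /kap indicE. Qed.

Let hkap z : `|kap z| <= 1.
Proof. by rewrite ger0_norm// /kap indicE; case: (_ \in _). Qed.

Let kapE1 x y : kap (x, y) = \1_`](x - l - d), (x - l)[ y.
Proof.
rewrite /kap !indicE /= !mem_setE !in_itv/=; congr (nat_of_bool _)%:R.
by apply/idP/idP => /andP[? ?]; apply/andP; split; lra.
Qed.

Let kapE2 x y : kap (x, y) = \1_`](y + l), (y + l + d)[ x.
Proof.
rewrite /kap !indicE /= !mem_setE !in_itv/=; congr (nat_of_bool _)%:R.
by apply/idP/idP => /andP[? ?]; apply/andP; split; lra.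
Qed.

Let kap_neq0 x y : kap (x, y) != 0 -> l < x - y < l + d.
Proof.
by rewrite /kap indicE /= mem_setE in_itv /=; case: andP => // _; rewrite eqxx.
Qed.

Let rho (x : R) := expR (- (3 / l * x)).
Let rho_gt0 x : 0 < rho x. Proof. exact: expR_gt0. Qed.
Let mrho : measurable_fun setT rho.
Proof.
apply: measurableT_comp => //; apply: measurableT_comp => //.
Qed.
Let rho_le1 x : 0 <= x -> rho x <= 1.
Proof.
by move=> x0; rewrite -expR0 ler_expR oppr_le0 mulr_ge0// divr_ge0// ltW.
Qed.
(* 3 / l is chosen so that a shift by l costs exp 3 >= 1 + 3. *)
Let rho_decay x y : y + l <= x -> rho x <= rho y / 4.
Proof.
move=> yx; have e4 : 4 <= expR (3 : R) by rewrite (le_trans _ (expR_ge1Dx _))//; lra.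
apply: (@le_trans _ _ (rho y * expR (- 3))).
  rewrite /rho -expRD ler_expR -opprD lerN2.
  rewrite -[X in _ + X](divfK (lt0r_neq0 l0)) -mulrDr ler_wpM2l//.
  by rewrite divr_ge0// ltW.
by rewrite expRN ler_pM2l// lef_pV2 ?posrE ?expR_gt0.
Qed.
Let rho_ge x : x <= 1 -> expR (- (3 / l)) <= rho x.
Proof.
move=> x1; rewrite ler_expR lerN2 -[leRHS]mulr1 ler_wpM2l//.
by rewrite divr_ge0// ltW.
Qed.

Let I := (`]0, 1[%classic : set R).
Let II x : I x -> 0 < x < 1. Proof. by rewrite /I /= in_itv. Qed.
Let mI : @measurable _ (measurableTypeR R) I. Proof. exact: measurable_oo. Qed.
Let I1 : intg I (fun=> 1). Proof. exact: (intg_cst mI (mu_itv_lty _ _)). Qed.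
Let Iq : intg I q. Proof. exact: (sqi_intg mI (mu_itv_lty _ _) sq). Qed.
Let Iq2 : intg I (fun x => q x ^+ 2). Proof. by case: sq. Qed.

Let h x := rho x * q x ^+ 2.
Let Ih : intg I h.
Proof.
apply: (intg_bdM mI _ (c := 1)) => //; first exact: measurable_funTS.
by move=> x /II /andP[x0 _]; rewrite gtr0_norm// rho_le1// ltW.
Qed.
Let h_ge0 x : 0 <= h x. Proof. by rewrite mulr_ge0 ?sqr_ge0// ltW. Qed.

Let k x := \int[mu]_(y in I) (kap (x, y) * 1).
Let Kc x := \int[mu]_(y in `]-1, 0[) J (x - y).
Let e x := \int[mu]_(y in I) (J (x - y) * (q y - q x) ^+ 2).

Let Jm1 x : intg `]-1, 0[ (fun y => J (x - y)).
Proof.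
have := intg_section1 (measurable_oo (-1 : R) 0) mK hK x (intg_cst (measurable_oo (-1 : R) 0) (mu_itv_lty _ _) 1).
by apply: (eq_intg (measurable_oo _ _)) => y _; rewrite mulr1.
Qed.

Let Ie x : intg I (fun y => J (x - y) * (q y - q x) ^+ 2).
Proof.
apply: (intg_section1 mI mK hK x (g := fun y => (q y - q x) ^+ 2)).
have sc := sqi_cst mI (mu_itv_lty _ _) (q x).
by case: (sqiB mI sq sc).
Qed.

Let k_ge x : I x -> l + d <= x -> d <= k x.
Proof.
move=> /II /andP[_ x1] ldx; rewrite /k; have [l0' d0'] := (l0, d0).
rewrite [leLHS](_ : d = 1 * ((x - l) - (x - l - d))); last by ring.
apply: Rintegral_ge_itv => //.
- lra.
- by apply: itv_oo_sub; lra.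
- exact: (intg_section1 mI mkap hkap x I1).
- by move=> y _; rewrite mulr1.
by move=> y yx; rewrite mulr1 kapE1 indicE mem_setE in_itv /= yx.
Qed.

Let Kc_ge x : I x -> x <= l + d -> c * d <= Kc x.
Proof.
move=> /II /andP[x0 _] xld; rewrite /Kc; have [l0' d0' ld1'] := And3 l0 d0 ld1.
rewrite (_ : c * d = c * ((x - l - d) - (x - l - 2 * d))); last by ring.
apply: (Rintegral_ge_itv (measurable_oo _ _)) => //.
- lra.
- by apply: itv_oo_sub; lra.
by move=> y /andP[? ?]; apply: Jc; apply/andP; split; lra.
Qed.

(* The first inequality, integrated in y: k(x) is the mass of the neighbours. *)
Let pt1 x : I x ->
  h x * k x <= 2 / c * e x + 2^-1 * (1 * \int[mu]_(y in I) (kap (x, y) * h y)).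
Proof.
move=> /II /andP[x0 x1]; have [l0' d0'] := (l0, d0).
have s1 := intg_section1 mI mkap hkap x I1.
have sh := intg_section1 mI mkap hkap x Ih.
rewrite mul1r /k -RintegralZl// /e -RintegralZl// -[2^-1 * _]RintegralZl//.
rewrite -RintegralD//; [|exact: intgZ..].
apply: le_Rintegral => //; [exact: intgZ|by apply: intgD => //; exact: intgZ|].
move=> y _; have Je := mulr_ge0 (J0 (x - y)) (sqr_ge0 (q y - q x)).
have [->|kn0] := eqVneq (kap (x, y)) 0.
  rewrite !mul0r !mulr0 addr0 mulr_ge0// divr_ge0//; exact: ltW.
have /andP[xy1 xy2] := kap_neq0 kn0.
have -> : kap (x, y) = 1.
  by rewrite /kap indicE mem_setE in_itv /= xy1 xy2.
rewrite mulr1 mul1r mulr1.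
have hy : rho x * q y ^+ 2 <= h y / 4.
  rewrite /h mulrAC ler_wpM2r ?sqr_ge0// rho_decay//; lra.
have hx : h x <= 2 * (rho x * (q y - q x) ^+ 2) + 2 * (rho x * q y ^+ 2).
  rewrite /h -subr_ge0 (_ : _ - _ = rho x * (2 * q y - q x) ^+ 2); last by ring.
  by rewrite mulr_ge0 ?sqr_ge0// ltW.
have rJ : rho x * (q y - q x) ^+ 2 <= c^-1 * (J (x - y) * (q y - q x) ^+ 2).
  rewrite [leRHS]mulrA ler_wpM2r ?sqr_ge0//; apply: (le_trans (rho_le1 (ltW x0))).
  by rewrite -(mulVf (lt0r_neq0 c0)) ler_pM2l ?invr_gt0// Jc//; apply/andP; split; lra.
rewrite -mulrA; lra.
Qed.

Let IhK : intg I (fun x => h x * k x).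
Proof. exact: (intg_kernel1 mI mI mkap hkap Ih I1). Qed.

Let KcE x : Kc x = \int[mu]_(y in `]-1, 0[) (K (x, y) * 1).
Proof. by apply: eq_Rintegral => y _; rewrite mulr1. Qed.

Let IKc : intg I (fun x => Kc x * q x ^+ 2).
Proof.
have I1' := intg_cst (measurable_oo (-1 : R) 0) (mu_itv_lty (-1 : R) 0) (1 : R).
have := intg_kernel1 mI (measurable_oo (-1 : R) 0) mK hK Iq2 I1'.
by apply: eq_intg => // x _; rewrite KcE mulrC.
Qed.

(* Either x has neighbours to its left, or it is close to the interface. *)
Let pt2 x : I x -> d * h x <= h x * k x + c^-1 * (Kc x * q x ^+ 2).
Proof.
move=> Ix; have [x0 x1] : 0 < x /\ x < 1 by move: Ix => /II /andP.
have k0 : 0 <= k x by apply: Rintegral_ge0 => y _; rewrite mulr1.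
have Kc0 : 0 <= Kc x by apply: Rintegral_ge0.
have [ldx|xld] := leP (l + d) x.
  rewrite mulrC; apply: (@le_trans _ _ (h x * k x)).
    by rewrite ler_wpM2l// k_ge.
  by rewrite lerDl mulr_ge0 ?invr_ge0 ?(ltW c0)// mulr_ge0 ?sqr_ge0.
apply: (@le_trans _ _ (c^-1 * (Kc x * q x ^+ 2))); last by rewrite lerDr mulr_ge0.
have cd := Kc_ge Ix (ltW xld).
have : d <= c^-1 * Kc x by rewrite mulrC ler_pdivlMr// mulrC.
move=> dK; rewrite [leRHS]mulrA; apply: (@le_trans _ _ (d * q x ^+ 2)).
  by rewrite ler_pM2l// /h ler_piMl ?sqr_ge0// rho_le1// ltW.
by rewrite ler_wpM2r ?sqr_ge0.
Qed.

(** With [h] = rho q^2, integrating the two pointwise bounds and summing gives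
d * int h <= 2 / c * E + d / 2 * int h + 1 / c * int Kc q^2, where the middle
term, already weakened by the decay of rho, is absorbed on the left. *)
Lemma nonlocal_coercive :
  d * c / 2 * expR (- (3 / l)) * \int[mu]_(x in `]0, 1[) q x ^+ 2 <=
  2 * \int[mu]_(x in `]0, 1[) \int[mu]_(y in `]0, 1[) (J (x - y) * (q y - q x) ^+ 2)
  + \int[mu]_(x in `]0, 1[) ((\int[mu]_(y in `]-1, 0[) J (x - y)) * q x ^+ 2).
Proof.
have aux (H HK E Q : R) : HK <= 2 / c * E + 2^-1 * (d * H) ->
    d * H <= HK + c^-1 * Q -> d / 2 * H <= c^-1 * (2 * E + Q) by lra.
have iE : intg I e.
  exact: (intg_energy_density mI (mu_itv_lty _ _) mJ JM sq).
have iM : intg I (fun x => 1 * \int[mu]_(y in I) (kap (x, y) * h y)).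
  exact: (intg_kernel1 mI mI mkap hkap I1 Ih).
have B1 : \int[mu]_(x in I) (h x * k x) <= 2 / c * \int[mu]_(x in I) e x +
    2^-1 * (d * \int[mu]_(x in I) h x).
  apply: (@le_trans _ _ (2 / c * \int[mu]_(x in I) e x +
      2^-1 * \int[mu]_(x in I) (1 * \int[mu]_(y in I) (kap (x, y) * h y)))).
    rewrite -RintegralZl// -[2^-1 * _]RintegralZl// -RintegralD//; [|exact: intgZ..].
    by apply: le_Rintegral => //; by apply: intgD => //; exact: intgZ.
  rewrite lerD2l ler_pM2l ?invr_gt0//.
  rewrite (kernel_swap mI mI mkap hkap I1 Ih) -RintegralZl//.
  apply: le_Rintegral => //; [|exact: intgZ|].
    pose kap' z := kap (z.2, z.1).
    have mkap' : measurable_fun setT kap'.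
      apply: (measurableT_comp mkap) => //.
      exact: measurable_fun_pair.
    exact: (intg_kernel1 (K := kap') mI mI mkap' (fun z => hkap _) Ih I1).
  move=> y _; rewrite mulrC ler_wpM2r//.
  under eq_Rintegral do rewrite mulr1 kapE2.
  have := @Rintegral_indic_itv_le _ I (y + l) (y + l + d) mI.
  rewrite (_ : y + l + d - (y + l) = d); last by ring.
  by apply; rewrite lerDl ltW.
have B2 : d * \int[mu]_(x in I) h x <= \int[mu]_(x in I) (h x * k x) +
    c^-1 * \int[mu]_(x in I) (Kc x * q x ^+ 2).
  rewrite -RintegralZl// -[c^-1 * _]RintegralZl// -RintegralD//; last exact: intgZ.
  by apply: le_Rintegral => //; [exact: intgZ|apply: intgD => //; exact: intgZ].
have B3 : expR (- (3 / l)) * \int[mu]_(x in I) q x ^+ 2 <= \int[mu]_(x in I) h x.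
  rewrite -RintegralZl//; apply: le_Rintegral => //; first exact: intgZ.
  move=> x /II /andP[_ x1].
  by rewrite ler_wpM2r ?sqr_ge0// rho_ge// ltW.
have B4 : d / 2 * \int[mu]_(x in I) h x <= c^-1 * (2 * \int[mu]_(x in I) e x +
    \int[mu]_(x in I) (Kc x * q x ^+ 2)).
  exact: aux B1 B2.
apply: (@le_trans _ _ (c * (d / 2 * \int[mu]_(x in I) h x))).
  rewrite -mulrA [leRHS](_ : _ = d * c / 2 * \int[mu]_(x in I) h x); last by ring.
  by rewrite ler_pM2l// divr_gt0// mulr_gt0.
by rewrite -ler_pdivlMl.
Qed.

End coercivity.

(** * Smooth steps and tents *)

Section smooth_step.
Variable R : realType.
Implicit Types x h s : R.
Local Notation mu := (@leb R).

(** Spares the case analysis at the points where the pieces of a piecewise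
quadratic function meet. *)
Lemma derivable_quadratic_remainder (F : R -> R) (s l C : R) :
  (forall t, `|F (t + s) - F s - l * t| <= C * t ^+ 2) ->
  derivable F s 1 /\ derive1 F s = l.
Proof.
move=> hF.
have cF : h^-1 *: (F (h *: 1 + s) - F s) @[h --> 0^'] --> l.
  apply/cvgrPdist_le => e e0; near=> h.
  have h0 : h != 0 by near: h; exact: nbhs_dnbhs_neq.
  have he : `|h| <= e / (`|C| + 1).
    near: h; apply: dnbhs0_le; rewrite divr_gt0// ltr_wpDl.
  rewrite /= (_ : h *: 1 = h); last by rewrite /GRing.scale /= mulr1.
  rewrite (_ : l - _ = - (h^-1 * (F (h + s) - F s - l * h))); last first.
    by rewrite /GRing.scale /=; field.
  rewrite normrN normrM normfV ler_pdivrMl ?normr_gt0//.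
  apply: (le_trans (hF h)); rewrite -real_normK ?num_real// expr2 mulrCA ler_wpM2l//.
  have C1 : 0 < `|C| + 1 by rewrite ltr_wpDl.
  move: he; rewrite ler_pdivlMr// mulrC; apply: le_trans.
  by rewrite ler_wpM2r// (le_trans (ler_norm _))// lerDl.
split; first by apply/cvg_ex; exists l.
by rewrite derive1E; apply/cvg_lim.
Unshelve. all: by end_near. Qed.

(** A C^1 function with derivative 2|s|: its second differences build C^1
functions that are locally constant outside a compact set. *)
Definition signed_sqr s : R := s * `|s|.

(** On each side of 0 this is Taylor's formula for the square; across 0 both
bounds reduce to squares being nonnegative. *)
Lemma signed_sqr_remainder s t :
  `|signed_sqr (t + s) - signed_sqr s - 2 * `|s| * t| <= t ^+ 2.
Proof.
rewrite /signed_sqr ler_norml.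
have [s0|s0] := leP 0 s; have [ts0|ts0] := leP 0 (t + s).
- by rewrite !ger0_norm//; apply/andP; split; nra.
- by rewrite (ger0_norm s0) ltr0_norm//; apply/andP; split; nra.
- by rewrite (ltr0_norm s0) ger0_norm//; apply/andP; split; nra.
- by rewrite !ltr0_norm//; apply/andP; split; nra.
Qed.

(** A second difference with step h of [signed_sqr], normalized to go from 0 on
the left of x - h to 1 on the right of x + h. Its derivative is [tent], the
piecewise linear bump of height 1 / h and mass 1 on ]x - h, x + h[. *)
Definition smooth_step x h s : R :=
  2^-1 + (signed_sqr (s - x + h) - 2 * signed_sqr (s - x)
          + signed_sqr (s - x - h)) / (4 * h ^+ 2).

Definition tent x h s : R :=
  (`|s - x + h| - 2 * `|s - x| + `|s - x - h|) / (2 * h ^+ 2).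

Variables (x h : R).
Hypothesis h0 : 0 < h.

Lemma smooth_step_derive s :
  derivable (smooth_step x h) s 1 /\ derive1 (smooth_step x h) s = tent x h s.
Proof.
apply: (derivable_quadratic_remainder (C := (h ^+ 2)^-1)) => t.
have h0' : h != 0 by rewrite gt_eqF.
have r1 := signed_sqr_remainder (s - x + h) t.
have r2 := signed_sqr_remainder (s - x) t.
have r3 := signed_sqr_remainder (s - x - h) t.
rewrite [X in `|X|](_ : _ =
   ((signed_sqr (t + (s - x + h)) - signed_sqr (s - x + h) - 2 * `|s - x + h| * t)
   - 2 * (signed_sqr (t + (s - x)) - signed_sqr (s - x) - 2 * `|s - x| * t)
   + (signed_sqr (t + (s - x - h)) - signed_sqr (s - x - h) - 2 * `|s - x - h| * t))
   / (4 * h ^+ 2)); last first.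
  rewrite /smooth_step /tent !addrA.
  by field.
have h2 : 0 < 4 * h ^+ 2 by rewrite mulr_gt0// exprn_gt0.
rewrite normrM normfV (gtr0_norm h2) ler_pdivrMr//.
rewrite [leRHS](_ : _ = 4 * t ^+ 2); last by field.
move: r1 r2 r3; rewrite !ler_norml => /andP[? ?] /andP[? ?] /andP[? ?].
by apply/andP; split; lra.
Qed.

Let h2 : 0 < 2 * h ^+ 2. Proof. by rewrite mulr_gt0// exprn_gt0. Qed.

Lemma tent_continuous : continuous (tent x h).
Proof.
move=> s; apply: cvgMl.
have cs c : (fun z : R => z - x + c) @ s --> s - x + c.
  by apply: cvgD; [apply: cvgB|]; [exact: cvg_id|exact: cvg_cst|exact: cvg_cst].
apply: cvgD; last exact: cvg_norm (cs (- h)).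
apply: cvgB; first exact: cvg_norm (cs h).
apply: cvgMr; apply: cvg_norm.
by apply: cvgB; [exact: cvg_id|exact: cvg_cst].
Qed.

(** Convexity of the absolute value. *)
Lemma tent_ge0 s : 0 <= tent x h s.
Proof.
rewrite divr_ge0//; last exact: ltW.
have := ler_normD (s - x + h) (s - x - h).
rewrite (_ : _ + _ = 2 * (s - x)); last by ring.
by rewrite normrM ger0_norm//; lra.
Qed.

Lemma tent_le s : tent x h s <= h^-1.
Proof.
have h0' : h != 0 by rewrite gt_eqF.
rewrite ler_pdivrMr// (_ : h^-1 * _ = 2 * h); last by field.
have := ler_normD (s - x) h; have := ler_normD (s - x) (- h).
by rewrite normrN (gtr0_norm h0); lra.
Qed.

Lemma tent_out s : h <= `|s - x| -> tent x h s = 0.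
Proof.
rewrite /tent ler_normr; have hh := h0 => /orP[hs|hs].
  by rewrite !ger0_norm; lra.
by rewrite !ler0_norm; lra.
Qed.

Lemma smooth_step_left s : s <= x - h -> smooth_step x h s = 0.
Proof.
move=> sx; have hh := h0; have h0' : h != 0 by rewrite gt_eqF.
rewrite /smooth_step /signed_sqr !ler0_norm; try lra.
by field.
Qed.

Lemma smooth_step_right s : x + h <= s -> smooth_step x h s = 1.
Proof.
move=> sx; have hh := h0; have h0' : h != 0 by rewrite gt_eqF.
rewrite /smooth_step /signed_sqr !ger0_norm; try lra.
by field.
Qed.

Lemma smooth_step_itv s : 0 <= smooth_step x h s <= 1.
Proof.
have hh := h0; have h0' : h != 0 by rewrite gt_eqF.
have [sl|sl] := leP s (x - h); first by rewrite smooth_step_left// lexx ler01.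
have [sr|sr] := leP (x + h) s; first by rewrite smooth_step_right// lexx ler01.
have h4 : 0 < 4 * h ^+ 2 by rewrite mulr_gt0// exprn_gt0.
rewrite /smooth_step /signed_sqr (@ger0_norm _ (s - x + h)); last lra.
rewrite (@ler0_norm _ (s - x - h)); last lra.
set N := (X in _ + X / _).
rewrite (_ : 2^-1 + _ = (2 * h ^+ 2 + N) / (4 * h ^+ 2)); last by field.
rewrite ler_pdivlMr// ler_pdivrMr// mul0r mul1r /N.
have [s0|s0] := leP 0 (s - x); [rewrite ger0_norm//|rewrite ltr0_norm//].
  by apply/andP; split; nra.
by apply/andP; split; nra.
Qed.

Lemma intg_tent (u v : R) : intg `]u, v[ (tent x h).
Proof.
apply: (@intg_bounded _ _ (measurable_oo u v) _ _ h^-1); first exact: mu_itv_lty.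
  apply: measurable_funTS; apply: continuous_measurable_fun.
  exact: tent_continuous.
by move=> s _; rewrite ger0_norm ?tent_ge0// tent_le.
Qed.

Lemma Rintegral_tent : \int[mu]_(s in ball x h) tent x h s = 1.
Proof.
have xh : x - h < x + h by have := h0; lra.
have step_cont : continuous (smooth_step x h).
  move=> s; apply: differentiable_continuous; apply/derivable1_diffP.
  by case: (smooth_step_derive s).
rewrite ball_itv Rintegral_itv_bndo_bndc; last first.
  apply: (@integrableS _ _ _ mu `](x - h - 1), (x + h + 1)[) => //.
    by move=> s /=; rewrite !in_itv /= => /andP[? ?]; apply/andP; split; lra.
  exact: intg_tent.
rewrite Rintegral_itv_obnd_cbnd; last first.
  apply: (@integrableS _ _ _ mu `](x - h - 1), (x + h + 1)[) => //.
    by move=> s /=; rewrite !in_itv /= => /andP[? ?]; apply/andP; split; lra.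
  exact: intg_tent.
rewrite /Rintegral (continuous_FTC2 (F := smooth_step x h) xh).
- by rewrite (smooth_step_right (lexx _)) (smooth_step_left (lexx _)) /= subr0.
- by apply: continuous_subspaceT => s; exact: tent_continuous.
- split; first by move=> s _; case: (smooth_step_derive s).
    by apply: cvg_at_right_filter; exact: step_cont.
  by apply: cvg_at_left_filter; exact: step_cont.
by move=> s _; case: (smooth_step_derive s).
Qed.

End smooth_step.

(** * Testing a weak derivative against smooth indicators *)

Section weak_derivatives.
Variable R : realType.
Implicit Types (a b x y h s : R) (f g : R -> R).
Local Notation mu := (@leb R).

Lemma smooth_indicator_test a b x y h : 0 < h -> x <= y -> a < x - h -> y + h < b ->
  test_function a b (fun s => smooth_step x h s - smooth_step y h s) /\
  derive1 (fun s => smooth_step x h s - smooth_step y h s) =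
    (fun s => tent x h s - tent y h s).
Proof.
move=> h0 xy ax yb.
pose phi s := smooth_step x h s - smooth_step y h s.
have dphi s : derivable phi s 1 /\ derive1 phi s = tent x h s - tent y h s.
  have [dx ex] := smooth_step_derive x h0 s.
  have [dy ey] := smooth_step_derive y h0 s.
  split; first exact: derivableB.
  by rewrite derive1E (deriveB dx dy) -!derive1E ex ey.
have dE : derive1 phi = (fun s => tent x h s - tent y h s).
  by apply/funext => s; case: (dphi s).
have supp : closure [set s | phi s != 0] `<=` `[x - h, y + h].
  rewrite closureE; apply: smallest_sub; first exact: interval_closed.
  move=> s /= phis; rewrite in_itv /=; apply/andP; split.
    rewrite leNgt; apply: contra phis => sx; rewrite /phi.
    by rewrite !smooth_step_left ?subrr//; [lra|exact: ltW].
  rewrite leNgt; apply: contra phis => sx; rewrite /phi.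
  by rewrite !smooth_step_right ?subrr//; [exact: ltW|lra].
split; last exact: dE.
split.
- by move=> s; case: (dphi s).
- rewrite dE => s; apply: cvgB; exact: tent_continuous.
- apply: (subclosed_compact (@closed_closure _ _) _ supp); exact: segment_compact.
- apply: (subset_trans supp) => s /=; rewrite !in_itv /= => /andP[? ?].
  by apply/andP; split; lra.
Qed.

Lemma measurable_ball_oo x h : @measurable _ (measurableTypeR R) (ball x h).
Proof. by rewrite ball_itv; exact: measurable_oo. Qed.

(** Averaging against the tent, which has mass 1 and height 1 / h on a ball of
measure 2 h, costs at most twice the mean deviation over the ball. *)
Lemma tent_average a b f x h (e : R) : 0 < h -> a <= x - h -> x + h <= b ->
  intg `]a, b[ f -> (davg (f \_ `]a, b[) x h <= e%:E)%E ->
  `|\int[mu]_(s in `]a, b[) (f s * tent x h s) - f x| <= 2 * e.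
Proof.
move=> h0 ax xb If dav.
have mB := measurable_ball_oo x h.
have Bab : ball x h `<=` `]a, b[.
  by rewrite ball_itv; exact: itv_oo_sub.
have xab : x \in `]a, b[%classic.
  by rewrite mem_setE in_itv /=; apply/andP; split; lra.
have fB : (mu (ball x h) < +oo)%E by rewrite ball_itv; exact: mu_itv_lty.
have IfB := intgS (measurable_oo a b) mB Bab If.
have Ic := intg_cst mB fB (f x).
have Id := intgB mB IfB Ic.
have mt : measurable_fun (ball x h) (tent x h).
  by apply: measurable_funTS; apply: continuous_measurable_fun; exact: tent_continuous.
have bt s : ball x h s -> `|tent x h s| <= h^-1.
  by move=> _; rewrite ger0_norm ?tent_ge0 ?tent_le.
have Itd : intg (ball x h) (fun s => tent x h s * (f s - f x)).
  exact: (intg_bdM mB mt bt Id).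
have Itf : intg (ball x h) (fun s => tent x h s * f s) by exact: (intg_bdM mB mt bt IfB).
have Itc : intg (ball x h) (fun s => tent x h s * f x) by exact: (intg_bdM mB mt bt Ic).
have It : intg (ball x h) (tent x h).
  by rewrite ball_itv; exact: intg_tent.
have -> : \int[mu]_(s in `]a, b[) (f s * tent x h s) - f x =
    \int[mu]_(s in ball x h) (tent x h s * (f s - f x)).
  have -> : \int[mu]_(s in `]a, b[) (f s * tent x h s) =
      \int[mu]_(s in ball x h) (tent x h s * f s).
    rewrite -[in RHS](setIidr Bab) Rintegral_mkcondr.
    apply: eq_Rintegral => s _; rewrite patchE mulrC; case: ifPn => //.
    rewrite notin_setE /ball /= => /negP; rewrite -leNgt distrC => hs.
    by rewrite tent_out ?mul0r.
  under [RHS]eq_Rintegral do rewrite mulrBr.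
  by rewrite RintegralB// RintegralZr// Rintegral_tent// mul1r.
apply: (le_trans (le_normr_Rintegral mB Itd)).
apply: (@le_trans _ _ (h^-1 * \int[mu]_(s in ball x h) `|f s - f x|)).
  rewrite -RintegralZl//; last exact: integrable_norm.
  apply: le_Rintegral => //; first exact: integrable_norm.
    by apply: intgZ => //; exact: integrable_norm.
  by move=> s Bs; rewrite normrM ler_wpM2r// bt.
move: dav; rewrite /davg /iavg lebesgue_measure_ball; last exact: ltW.
rewrite (_ : \int[_]_(y in _) _ = (\int[mu]_(s in ball x h) `|f s - f x|)%:E)%E; last first.
  rewrite /Rintegral fineK; last first.
    by apply: integrable_fin_num => //; exact: (integrable_norm Id).
  apply: eq_integral => s sB; rewrite /= !patchE xab ifT//.
  by rewrite inE; apply: Bab; rewrite inE in sB.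
have h2 : 0 < h *+ 2 by rewrite mulrn_wgt0.
rewrite inver gt_eqF// -EFinM lee_fin.
rewrite ler_pdivrMl// ler_pdivrMl// => /le_trans; apply.
by rewrite -[h *+ 2]mulr_natr; lra.
Qed.

Lemma smooth_indicator_norm_le1 x y h s : 0 < h ->
  `|smooth_step x h s - smooth_step y h s| <= 1.
Proof.
move=> h0; rewrite ler_norml.
move: (smooth_step_itv x h0 s) (smooth_step_itv y h0 s).
move: (smooth_step x h s) (smooth_step y h s) => u v /andP[? ?] /andP[? ?].
by apply/andP; split; lra.
Qed.

(** The smooth indicator differs from the sharp one only on the two
transition balls; the constant 2 is crude but avoids comparing the steps. *)
Lemma smooth_indicator_dist x y h s : 0 < h -> x <= y ->
  `|smooth_step x h s - smooth_step y h s - \1_`]x, y[ s|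
    <= 2 * (\1_(ball x h) s + \1_(ball y h) s).
Proof.
move=> h0 xy.
have ind0 (A : set R) : 0 <= \1_A s :> R by rewrite indicE.
have near2 : `|smooth_step x h s - smooth_step y h s - \1_`]x, y[ s| <= 2.
  apply: le_trans (ler_normB _ _) _.
  rewrite -[leRHS]/(1 + 1) lerD ?smooth_indicator_norm_le1//.
  by rewrite indicE; case: (_ \in _); rewrite ?normr1 ?normr0.
have [sx|sx] := boolP (s \in (ball x h : set R)).
  rewrite [X in _ * (X + _)]indicE sx mulr1n; apply: (le_trans near2).
  by rewrite mulrDr mulr1 lerDl mulr_ge0.
have [sy|sy] := boolP (s \in (ball y h : set R)).
  rewrite [X in _ * (_ + X)]indicE sy mulr1n; apply: (le_trans near2).
  by rewrite mulrDr mulr1 lerDr mulr_ge0.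
rewrite [X in `|X|](_ : _ = 0) ?normr0 ?mulr_ge0 ?addr_ge0//.
have out z : s \notin (ball z h : set R) -> s <= z - h \/ z + h <= s.
  rewrite notin_setE /ball /= => /negP; rewrite -leNgt ler_normr => /orP[?|?].
    by left; lra.
  by right; lra.
rewrite indicE mem_setE in_itv /=.
have [sx'|sx'] := out _ sx.
  have sy' : s <= y - h by lra.
  have xs : (x < s) = false by apply/negbTE; rewrite -leNgt; lra.
  by rewrite (smooth_step_left h0 sx') (smooth_step_left h0 sy') xs !subrr.
have [sy'|sy'] := out _ sy.
  have [xs ys] : x < s /\ s < y by split; lra.
  by rewrite (smooth_step_right h0 sx') (smooth_step_left h0 sy') xs ys subr0 subrr.
have ys : (s < y) = false by apply/negbTE; rewrite -leNgt; lra.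
by rewrite (smooth_step_right h0 sx') (smooth_step_right h0 sy') ys andbF !subrr.
Qed.

Lemma smooth_indicator_average a b g x y h (e : R) :
  0 < h -> x <= y -> a < x - h -> y + h < b -> intg `]a, b[ g ->
  \int[mu]_(s in ball x h) `|(g \_ `]a, b[) s| <= e ->
  \int[mu]_(s in ball y h) `|(g \_ `]a, b[) s| <= e ->
  `|\int[mu]_(s in `]a, b[) (g s * (smooth_step x h s - smooth_step y h s))
    - \int[mu]_(s in `]x, y[) g s| <= 4 * e.
Proof.
move=> h0 xy ax yb.
have xysub : `]x, y[ `<=` `]a, b[ by apply: itv_oo_sub; lra.
have Bx : ball x h `<=` `]a, b[ by rewrite ball_itv; apply: itv_oo_sub; lra.
have By : ball y h `<=` `]a, b[ by rewrite ball_itv; apply: itv_oo_sub; lra.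
have aux (u v w : R) : u <= w -> v <= w -> 2 * (u + v) <= 4 * w by lra.
move=> Ig ex ey; have mI := measurable_oo a b.
pose phi s := smooth_step x h s - smooth_step y h s.
have mphi : measurable_fun setT phi.
  have cs z : measurable_fun setT (smooth_step z h).
    apply: continuous_measurable_fun => s.
    apply: differentiable_continuous; apply/derivable1_diffP.
    by case: (smooth_step_derive z h0 s).
  by apply: measurable_funB.
have phi1 s : `|phi s| <= 1 by exact: smooth_indicator_norm_le1.
have -> : \int[mu]_(s in `]x, y[) g s =
    \int[mu]_(s in `]a, b[) (\1_`]x, y[ s * g s).
  rewrite -(setIidr xysub) Rintegral_mkcondr setIidr//.
  apply: eq_Rintegral => s _; rewrite patchE indicE.
  by case: ifP => _; rewrite ?mul1r ?mul0r.
have I1 : intg `]a, b[ (fun s => phi s * g s).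
  exact: (intg_bdM mI (measurable_funTS mphi) (fun s _ => phi1 s) Ig).
have ind_bd (A : set R) s : `|\1_A s : R| <= 1.
  by rewrite indicE; case: (_ \in _); rewrite ?normr1 ?normr0.
have Iind (A : set R) f : measurable A -> intg `]a, b[ f ->
    intg `]a, b[ (fun s => \1_A s * f s).
  move=> mA; apply: (intg_bdM mI (c := 1)) => //.
have I2 := Iind _ _ (measurable_oo x y) Ig.
under [X in X - _]eq_Rintegral do rewrite mulrC -/(phi _).
rewrite -RintegralB//.
apply: (le_trans (le_normr_Rintegral mI (intgB mI I1 I2))).
have Ing : intg `]a, b[ (fun s => `|g s|) by exact: integrable_norm.
have J1 := Iind _ _ (measurable_ball_oo x h) Ing.
have J2 := Iind _ _ (measurable_ball_oo y h) Ing.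
have Bsub z : ball z h `<=` `]a, b[ ->
    \int[mu]_(s in ball z h) `|(g \_ `]a, b[) s| =
    \int[mu]_(s in `]a, b[) (\1_(ball z h) s * `|g s|).
  move=> zab; rewrite -(setIidr zab) Rintegral_mkcondr setIidr//.
  apply: eq_Rintegral => s sab; rewrite !patchE indicE sab.
  by case: ifP => _; rewrite ?mul1r ?mul0r.
rewrite !Bsub// in ex ey.
apply: (@le_trans _ _ (\int[mu]_(s in `]a, b[)
  (2 * (\1_(ball x h) s * `|g s| + \1_(ball y h) s * `|g s|)))); last first.
  rewrite RintegralZl//; last exact: intgD.
  rewrite RintegralD//.
  exact: (aux _ _ _ ex ey).
apply: le_Rintegral => //.
- by apply: integrable_norm; exact: intgB.
- by apply: intgZ => //; exact: intgD.
move=> s _; rewrite -mulrDl mulrA -mulrBl normrM ler_wpM2r//.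
exact: smooth_indicator_dist.
Qed.

End weak_derivatives.

(** * Functions with a weak derivative are primitives *)

Section primitives.
Variable R : realType.
Implicit Types (a b x y h s : R) (f g : R -> R).
Local Notation mu := (@leb R).

(** An interval of positive length is not negligible. *)
Lemma ae_witness (P : R -> Prop) u v : u < v ->
  (\forall x \ae mu, P x) -> exists2 x, u < x < v & P x.
Proof.
move=> uv [A [mA A0 PA]]; apply: contrapT => nex.
have sub : `]u, v[ `<=` A.
  move=> x /=; rewrite in_itv /= => xuv; apply: PA => /= Px.
  by apply: nex; exists x.
have : (mu `]u, v[ <= 0)%E.
  by rewrite -A0; apply: le_measure => //; rewrite inE//; exact: measurable_oo.
by rewrite (mu_itv (ltW uv)) lee_fin leNgt subr_gt0 uv.
Qed.

Lemma ae_mono2 (P Q S : R -> Prop) : (forall x, P x -> Q x -> S x) ->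
  (\forall x \ae mu, P x) -> (\forall x \ae mu, Q x) -> \forall x \ae mu, S x.
Proof.
move=> PQS aP aQ; apply: negligibleS (negligibleU aP aQ) => x /= nS.
by have [Px|nP] := pselect (P x); [right=> Qx; exact/nS/PQS|left].
Qed.

Lemma ae_mono (P S : R -> Prop) : (forall x, P x -> S x) ->
  (\forall x \ae mu, P x) -> \forall x \ae mu, S x.
Proof. by move=> PS aP; apply: (ae_mono2 _ aP aP) => x Px _; exact: PS. Qed.

Lemma davg_small f x (e : R) : 0 < e -> lebesgue_pt f x ->
  \forall h \near 0^'+, (davg f x h <= e%:E)%E.
Proof.
move=> e0 fx; have : nbhs (0%:E : \bar R) [set z | (z < e%:E)%E].
  by apply: open_nbhs_nbhs; split; [exact: open_ereal_lt_ereal|rewrite /= lte_fin].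
move/fx => Hx; near=> h; apply/ltW; near: h; exact: Hx.
Unshelve. all: by end_near. Qed.

Lemma Rintegral_ball_small g x (e : R) : 0 < e -> intg setT g ->
  \forall h \near 0^'+, \int[mu]_(s in ball x h) `|g s| <= e.
Proof.
move=> e0 Ig; have [d [d0 hd]] := integral_normr_continuous Ig e0.
near=> h; apply/ltW/hd; first exact: measurable_ball_oo.
have h0 : 0 < h by near: h; exact: nbhs_right_gt.
have muB : (mu (ball x h) <= (h *+ 2)%:E)%E.
  by rewrite (lebesgue_measure_ball _ (ltW h0)).
apply: (le_lt_trans muB); rewrite lte_fin -mulr_natr -ltr_pdivlMr//.
by near: h; apply: nbhs_right_lt; rewrite divr_gt0.
Unshelve. all: by end_near. Qed.

Section weak_primitive.
Variables (a b : R) (f g : R -> R).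
Hypotheses (If : intg `]a, b[ f) (Ig : intg `]a, b[ g).
Hypothesis fg : weak_derivative a b f g.

Let Ig' : intg setT (g \_ `]a, b[).
Proof.
move/(integrable_mkcond _ (measurable_oo a b)) : Ig.
by apply: eq_integrable => // x _; rewrite restrict_EFin.
Qed.

(** Testing against the smooth indicator phi of ]x, y[ gives
int f (tent_x - tent_y) = - int g phi. At Lebesgue points the left-hand side
tends to f(x) - f(y), and the right-hand side tends to - int_x^y g by absolute
continuity of the integral. *)
Lemma weak_derivative_increment x y : a < x -> x < y -> y < b ->
  lebesgue_pt (f \_ `]a, b[) x -> lebesgue_pt (f \_ `]a, b[) y ->
  f y - f x = \int[mu]_(s in `]x, y[) g s.
Proof.
move=> ax xy yb Lx Ly.
suff : forall e : R, 0 < e -> `|f y - f x - \int[mu]_(s in `]x, y[) g s| <= 0 + e.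
  by move/ler_addgt0Pr; rewrite normr_le0 subr_eq0 => /eqP.
move=> e e0; rewrite add0r.
have e8 : 0 < e / 8 by rewrite divr_gt0.
have aux (fx fy tx ty p q : R) : `|tx - fx| <= 2 * (e / 8) ->
    `|ty - fy| <= 2 * (e / 8) -> `|p - q| <= 4 * (e / 8) -> tx - ty = - p ->
    `|fy - fx - q| <= e.
  rewrite !ler_norml => /andP[? ?] /andP[? ?] /andP[? ?] ?.
  by apply/andP; split; lra.
have Fh : \forall h \near (0 : R)^'+,
    [/\ 0 < h, h < x - a, h < b - y & h < y - x].
  near=> h; split; near: h; first exact: nbhs_right_gt.
  - by apply: nbhs_right_lt; rewrite subr_gt0.
  - by apply: nbhs_right_lt; rewrite subr_gt0.
  - by apply: nbhs_right_lt; rewrite subr_gt0.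
have Rx := Rintegral_ball_small x e8 Ig'.
have Ry := Rintegral_ball_small y e8 Ig'.
have [h [[h0 hx hy hxy] [[dx gx] [dy gy]]]] := filter_ex (filterI Fh
  (filterI (filterI (davg_small e8 Lx) Rx) (filterI (davg_small e8 Ly) Ry))).
have [ax' xb' ay' yb'] : [/\ a < x - h, x + h <= b, a <= y - h & y + h < b].
  by clear -h0 hx hy hxy; split; lra.
have tx := @tent_average _ a b f x h (e / 8) h0 (ltW ax') xb' If dx.
have ty := @tent_average _ a b f y h (e / 8) h0 ay' (ltW yb') If dy.
have gxy := @smooth_indicator_average _ a b g x y h (e / 8) h0 (ltW xy)
  ax' yb' Ig gx gy.
have [tphi dphi] := @smooth_indicator_test _ a b x y h h0 (ltW xy) ax' yb'.
have := fg tphi; rewrite dphi.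
have It z : intg `]a, b[ (fun s => f s * tent z h s).
  apply: (eq_intg (measurable_oo a b) (f := fun s => tent z h s * f s)).
    by move=> s _; rewrite mulrC.
  apply: (intg_bdM (measurable_oo a b) _ (c := h^-1)) => //.
    by apply: measurable_funTS; apply: continuous_measurable_fun; exact: tent_continuous.
  by move=> s _; rewrite ger0_norm ?tent_ge0 ?tent_le.
under eq_Rintegral do rewrite mulrBr.
rewrite RintegralB//.
move=> fgE; exact: aux tx ty gxy fgE.
Unshelve. all: by end_near. Qed.

(** g is cut off so that the integrand is integrable on the closed interval,
where continuity up to the end points is needed. *)
Definition primitive x := \int[mu]_(s in `[a, x]) (g \_ `]a, b[) s.

Let Ig'S (E : set R) : measurable E -> intg E (g \_ `]a, b[).
Proof. by move=> mE; exact: (intgS measurableT mE (@subsetT _ _) Ig'). Qed.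

Lemma primitive_increment x y : a <= x -> x <= y -> y <= b ->
  primitive y - primitive x = \int[mu]_(s in `]x, y[) g s.
Proof.
move=> ax xy yb; have Iay : intg `[a, y] (g \_ `]a, b[) by exact: Ig'S.
have Ixy : intg `]x, y[ (g \_ `]a, b[) by exact: Ig'S.
rewrite /primitive (Rintegral_itvB Iay) ?bnd_simp//.
rewrite -(Rintegral_itv_bndo_bndc Ixy).
apply: eq_Rintegral => s; rewrite inE /= => sxy.
by rewrite patchE mem_set //=; exact: (itv_oo_sub ax yb).
Qed.

Lemma primitive_left : primitive a = 0.
Proof. by rewrite /primitive set_itv1 Rintegral_set1. Qed.

Lemma primitive_continuous : a <= b -> {within `[a, b], continuous primitive}.
Proof.
by move=> ab; apply: (parameterized_integral_continuous ab); exact: Ig'S.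
Qed.

(** The constant is read off at one Lebesgue point. *)
Lemma weak_derivative_primitive : a < b ->
  exists c, forall x, lebesgue_pt (f \_ `]a, b[) x -> a < x < b ->
    f x = c + primitive x.
Proof.
move=> ab.
have := lebesgue_differentiation (integrable_locally (measurable_oo a b) If).
move=> /(ae_witness ab)[x0 /andP[ax0 x0b] L0].
exists (f x0 - primitive x0) => x Lx /andP[ax xb].
have [xx0|x0x|->] := ltgtP x x0; last by rewrite subrK.
  have := weak_derivative_increment ax xx0 x0b Lx L0.
  rewrite -(primitive_increment (ltW ax) (ltW xx0) (ltW x0b)).
  by move/(canRL (subrK _)) => ->; ring.
have := weak_derivative_increment ax0 x0x xb L0 Lx.
rewrite -(primitive_increment (ltW ax0) (ltW x0x) (ltW xb)).
by move/(canRL (subrK _)) => ->; ring.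
Qed.

End weak_primitive.

Lemma continuous_ae_eq a b (F G : R -> R) : a < b ->
  {within `[a, b], continuous F} -> {within `[a, b], continuous G} ->
  F = G %[ae mu in `]a, b[%classic] -> forall x, a <= x <= b -> F x = G x.
Proof.
move=> ab cF cG FG x xab; apply/eqP; rewrite -subr_eq0; apply: contraT => d0.
have cD : {within `[a, b], continuous (fun z => F z - G z)}.
  by move=> z; apply: cvgB; [exact: cF|exact: cG].
have xI : `[a, b]%classic x by rewrite /= in_itv.
have := (subspace_continuousP _ _).1 cD x xI.
move=> /cvgrPdist_lt /(_ `|F x - G x|); rewrite normr_gt0 => /(_ d0).
rewrite /= near_withinE => -[e /= e0 he].
have [ax xb] := andP xab.
have uv : Num.max a (x - e) < Num.min b (x + e).
  by rewrite lt_min !gt_max; apply/andP; split; apply/andP; split; lra.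
have [z] := ae_witness uv FG.
rewrite lt_min gt_max => /andP[/andP[az xz] /andP[zb zx]] /(_ _) FGz.
have zab : `]a, b[%classic z by rewrite /= in_itv /= az zb.
have /he : ball_ Num.norm x e z by rewrite /= ltr_distl; apply/andP; split; lra.
have zI : `[a, b]%classic z by rewrite /= in_itv /= (ltW az) (ltW zb).
by move=> /(_ zI); rewrite /from_subspace /= (FGz zab) subrr subr0 ltxx.
Qed.

(** The continuous representative, chosen arbitrarily by the definition, is
determined on the closed interval. *)
Lemma cont_reprE a b (f F : R -> R) : a < b ->
  {within `[a, b], continuous F} -> f = F %[ae mu in `]a, b[%classic] ->
  forall x, a <= x <= b -> cont_repr a b f x = F x.
Proof.
move=> ab cF fF.
have [cg fg] : [set g : R -> R | {within `[a, b], continuous g} /\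
    f = g %[ae mu in `]a, b[%classic]] (cont_repr a b f).
  by apply: getPex; exists F.
apply: (continuous_ae_eq ab cg cF).
by apply: ae_mono2 fg fF => x h1 h2 abx; rewrite -h1 ?h2.
Qed.

End primitives.

(** * Energy identity and trace inequality on the local side *)

Section sobolev.
Variable R : realType.
Local Notation mu := (@leb R).

Lemma ae_eq_Rintegral (D : set R) (f g : R -> R) :
  @measurable _ (measurableTypeR R) D ->
  measurable_fun D f -> measurable_fun D g -> f = g %[ae mu in D] ->
  \int[mu]_(x in D) f x = \int[mu]_(x in D) g x.
Proof.
move=> mD mf mg fg; rewrite /Rintegral; congr fine.
apply: (ae_eq_integral _ _ mD); try exact/measurable_EFinP.
by apply: ae_mono fg => x fgx Dx; rewrite /= fgx.
Qed.

Lemma wderivP a b (f : R -> R) : H1 a b f ->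
  L2 a b (wderiv a b f) /\ weak_derivative a b f (wderiv a b f).
Proof.
move=> [_ ex]; rewrite /wderiv.
exact: (@getPex _ [set g : R -> R | L2 a b g /\ weak_derivative a b f g]).
Qed.

Section rep.
Variables (a b : R) (f g : R -> R).
Hypothesis ab : a < b.
Hypotheses (sf : sqi `]a, b[ f) (sg : sqi `]a, b[ g).
Hypothesis fg : weak_derivative a b f g.

Let mI := measurable_oo a b.
Let If : intg `]a, b[ f. Proof. exact: (sqi_intg mI (mu_itv_lty _ _) sf). Qed.
Let Ig : intg `]a, b[ g. Proof. exact: (sqi_intg mI (mu_itv_lty _ _) sg). Qed.

Lemma cont_repr_rep :
  [/\ {within `[a, b], continuous (cont_repr a b f)},
      f = cont_repr a b f %[ae mu in `]a, b[%classic] &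
      forall x y, a <= x -> x <= y -> y <= b ->
        cont_repr a b f y - cont_repr a b f x = \int[mu]_(s in `]x, y[) g s].
Proof.
have [c hc] := weak_derivative_primitive If Ig fg ab.
pose F x := c + primitive a b g x.
have cF : {within `[a, b], continuous F}.
  move=> z; apply: cvgD; first exact: cvg_cst.
  exact: (primitive_continuous Ig (ltW ab)).
have fF : f = F %[ae mu in `]a, b[%classic].
  have Lae := lebesgue_differentiation (integrable_locally mI If).
  apply: ae_mono Lae => x Lx; rewrite /= in_itv /= => xab.
  exact: hc.
have FE := cont_reprE ab cF fF.
have [cR fR] : [set h : R -> R | {within `[a, b], continuous h} /\
    f = h %[ae mu in `]a, b[%classic]] (cont_repr a b f).
  by apply: getPex; exists F.
split=> // x y ax xy yb; rewrite !FE ?ax ?yb ?(le_trans ax xy) ?(le_trans xy yb)//.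
by rewrite -(primitive_increment Ig ax xy yb) /F; ring.
Qed.

End rep.

Section energy.
Variables (a b : R) (f g k : R -> R).
Hypothesis ab : a < b.
Hypotheses (sf : sqi `]a, b[ f) (sg : sqi `]a, b[ g) (sk : sqi `]a, b[ k).
Hypotheses (fg : weak_derivative a b f g) (gk : weak_derivative a b g k).

Let mI := measurable_oo a b.
Let mu_lty := mu_itv_lty a b.
Let If : intg `]a, b[ f. Proof. exact: sqi_intg. Qed.
Let Ig : intg `]a, b[ g. Proof. exact: sqi_intg. Qed.
Let Ik : intg `]a, b[ k. Proof. exact: sqi_intg. Qed.
Let F := cont_repr a b f.
Let G := cont_repr a b g.

Let K (z : R * R) : R := \1_`]-oo, 0[ (z.1 - z.2).

Let mK : measurable_fun setT K.
Proof. by apply: measurable_diff_kernel; exact: measurable_indic. Qed.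

Let hK z : `|K z| <= 1.
Proof. by rewrite /K indicE; case: (_ \in _); rewrite ?normr1 ?normr0. Qed.

Let KE x s : K (x, s) = (x < s)%R%:R.
Proof. by rewrite /K indicE mem_setE in_itv /= subr_lt0. Qed.

Let above x : a <= x -> x <= b ->
  \int[mu]_(s in `]a, b[) (K (x, s) * g s) = F b - F x.
Proof.
move=> ax xb; have [_ _ FE] := cont_repr_rep ab sf sg fg.
rewrite (FE _ _ ax xb (lexx b)).
have sub : `]x, b[ `<=` `]a, b[ by exact: itv_oo_sub.
rewrite -(setIidr sub) Rintegral_mkcondr.
apply: eq_Rintegral => s; rewrite inE /= in_itv /= => /andP[as_ sb].
rewrite patchE mem_setE in_itv /= sb andbT KE.
by case: (x < s); rewrite ?mul1r ?mul0r.
Qed.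

Let below s : a <= s -> s <= b ->
  \int[mu]_(x in `]a, b[) (K (x, s) * k x) = G s - G a.
Proof.
move=> as_ sb; have [_ _ GE] := cont_repr_rep ab sg sk gk.
rewrite (GE _ _ (lexx a) as_ sb).
have sub : `]a, s[ `<=` `]a, b[ by exact: itv_oo_sub.
rewrite -(setIidr sub) Rintegral_mkcondr.
apply: eq_Rintegral => x; rewrite inE /= in_itv /= => /andP[ax xb].
rewrite patchE mem_setE in_itv /= ax KE.
by case: (x < s); rewrite ?mul1r ?mul0r.
Qed.

(** Integration by parts with G a = 0, where the boundary term at b disappears
because f is shifted by its trace at b. Writing F b - F x as an integral of g
over ]x, b[ and exchanging the integrals leaves the integral of g(s) G(s). *)
Lemma Dirichlet_energy : G a = 0 ->
  \int[mu]_(x in `]a, b[) (- k x * (f x - F b)) = \int[mu]_(x in `]a, b[) g x ^+ 2.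
Proof.
move=> Ga.
have [_ fF _] := cont_repr_rep ab sf sg fg.
have [_ gG _] := cont_repr_rep ab sg sk gk.
have mf := intg_meas If; have mg := intg_meas Ig; have mk := intg_meas Ik.
have i1 := intg_kernel1 mI mI mK hK Ik Ig.
have i2 : intg `]a, b[ (fun s => g s * \int[mu]_(x in `]a, b[) (K (x, s) * k x)).
  pose K' z := K (z.2, z.1).
  have mK' : measurable_fun setT K'.
    by apply: (measurableT_comp mK); exact: measurable_fun_pair.
  exact: (intg_kernel1 (K := K') mI mI mK' (fun z => hK _) Ig Ik).
transitivity (\int[mu]_(x in `]a, b[)
    (k x * \int[mu]_(s in `]a, b[) (K (x, s) * g s))).
  apply: ae_eq_Rintegral => //; [|exact: intg_meas i1|].
    apply: measurable_funM; first exact: measurable_funN.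
    exact: measurable_funB.
  apply: ae_mono fF => x fFx xab.
  have := xab; rewrite /= in_itv /= => /andP[ax xb].
  by rewrite (above (ltW ax) (ltW xb)) (fFx xab) /F; ring.
rewrite (kernel_swap mI mI mK hK Ik Ig).
apply: ae_eq_Rintegral => //; [exact: intg_meas i2|exact: measurable_funX|].
apply: ae_mono gG => s gGs sab.
have := sab; rewrite /= in_itv /= => /andP[as_ sb].
by rewrite (below (ltW as_) (ltW sb)) Ga subr0 /G -(gGs sab) expr2.
Qed.

Lemma flux_balance : G a = 0 -> \int[mu]_(x in `]a, b[) k x = G b.
Proof.
move=> Ga; have [_ _ GE] := cont_repr_rep ab sg sk gk.
by rewrite -(GE _ _ (lexx a) (ltW ab) (lexx b)) -/G Ga subr0.
Qed.

End energy.

Section trace.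
Variables (a b : R) (f g : R -> R).
Hypothesis ab : a < b.
Hypotheses (sf : sqi `]a, b[ f) (sg : sqi `]a, b[ g).
Hypothesis fg : weak_derivative a b f g.

(** F b - F x is the integral of g over ]x, b[, so that Cauchy-Schwarz bounds
its square by (b - a) * int g^2, uniformly in x. *)
Lemma trace_poincare :
  \int[mu]_(x in `]a, b[) (f x - cont_repr a b f b) ^+ 2
    <= (b - a) ^+ 2 * \int[mu]_(x in `]a, b[) g x ^+ 2.
Proof.
have mI := measurable_oo a b; have fI := mu_itv_lty a b.
have [_ fF FE] := cont_repr_rep ab sf sg fg.
set F := cont_repr a b f in fF FE *.
set E := \int[mu]_(x in _) g x ^+ 2.
have ba0 : 0 < b - a by rewrite subr_gt0.
(* With m = F b - F x and l = b - x, Cauchy-Schwarz is (l * g - m)^2 >= 0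
   integrated over ]x, b[, where the integral of g is m. *)
have aux (l d m e E' : R) : 0 < l -> l <= d -> 0 <= E' -> e <= E' ->
    2 * m * l * m <= l ^+ 2 * e + l * m ^+ 2 -> m ^+ 2 <= d * E'.
  move=> l0 ld E0 eE h; apply: (@le_trans _ _ (l * e)).
    rewrite -(ler_pM2l l0); nra.
  by rewrite (le_trans (ler_wpM2l (ltW l0) eE))// ler_wpM2r.
have pt x : a < x < b -> (F b - F x) ^+ 2 <= (b - a) * E.
  move=> /andP[ax xb].
  have sub : `]x, b[ `<=` `]a, b[ by apply: itv_oo_sub; [exact: ltW|].
  have mx := measurable_oo x b.
  have sgx : sqi `]x, b[ g.
    case: sg => mg Ig; split; first exact: measurable_funS mg.
    exact: (intgS mI mx sub Ig).
  have Igx := sqi_intg mx (mu_itv_lty _ _) sgx.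
  have [mgx Ig2x] := sgx.
  pose m := F b - F x.
  have mE : m = \int[mu]_(s in `]x, b[) g s by rewrite -FE// ltW.
  have Ic := intg_cst mx (mu_itv_lty _ _) (m ^+ 2).
  have : 2 * m * (b - x) * m <= (b - x) ^+ 2 * \int[mu]_(s in `]x, b[) g s ^+ 2
      + (b - x) * m ^+ 2.
    have -> : (b - x) * m ^+ 2 = \int[mu]_(s in `]x, b[) (m ^+ 2).
      by rewrite Rintegral_itv_cst ?ltW// mulrC.
    rewrite {2}mE -RintegralZl// -RintegralZl// -RintegralD//; last exact: intgZ.
    apply: le_Rintegral => //; first exact: intgZ.
      by apply: intgD => //; exact: intgZ.
    move=> s _; rewrite -subr_ge0.
    by rewrite (_ : _ - _ = ((b - x) * g s - m) ^+ 2) ?sqr_ge0//; ring.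
  have Ele : \int[mu]_(s in `]x, b[) g s ^+ 2 <= E.
    have Ig2 : intg `]a, b[ (fun s => g s ^+ 2) by case: sg.
    rewrite /E -(setIidr sub) Rintegral_mkcondr.
    apply: le_Rintegral => //.
      have : intg (`]a, b[ `&` `]x, b[) (fun s => g s ^+ 2) by rewrite setIidr.
      move/integrable_restrict => /(_ mx mI).
      by apply: eq_integrable => // s _; rewrite restrict_EFin.
    by move=> s _; rewrite patchE; case: ifP => // _; exact: sqr_ge0.
  have E0 : 0 <= E by apply: Rintegral_ge0 => s _; exact: sqr_ge0.
  have lbx : 0 < b - x by rewrite subr_gt0.
  have ld : b - x <= b - a by rewrite lerD2l lerN2 ltW.
  move: lbx ld E0 Ele; rewrite -/m.
  exact: aux.
have Iq : intg `]a, b[ (fun x => (f x - F b) ^+ 2).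
  by case: (sqiB mI sf (sqi_cst mI fI (F b))).
rewrite expr2 -mulrA mulrC -Rintegral_itv_cst; last exact: ltW.
rewrite /Rintegral; apply: fine_le.
- exact: (integrable_fin_num mI (f := EFin \o (fun x => (f x - F b) ^+ 2)) Iq).
- exact: (integrable_fin_num mI (intg_cst mI fI _)).
apply: ae_ge0_le_integral => //.
- by move=> x _; rewrite lee_fin sqr_ge0.
- exact: measurable_int Iq.
- by move=> x _; rewrite lee_fin mulr_ge0 ?Rintegral_ge0 ?ltW// => y _; exact: sqr_ge0.
apply: ae_mono fF => x fFx xab.
by rewrite lee_fin (fFx xab) -sqrrN opprB; apply: pt; move: xab; rewrite /= in_itv.
Qed.

End trace.

End sobolev.

(** * Dissipation of the coupled operator *)

Section dissipation.
Variables (R : realType) (J : R -> R) (C1 C2 : R).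
Hypotheses (hJ : admissible_kernel J) (hC1 : 0 < C1) (hC2 : 0 < C2).
Local Notation mu := (@leb R).

Section local_part.
Variable w : R -> R.
Hypothesis dw : domB J C2 w.

(** What leaves ]-1, 0[ is the flux through 0, as u'(-1) = 0. *)
Lemma local_mean :
  intg `]-1, 0[ (opB J C1 C2 w) /\
  \int[mu]_(x in `]-1, 0[) opB J C1 C2 w x =
    - (C2 * \int[mu]_(x in `]-1, 0[)
              (\int[mu]_(y in `]0, 1[) (J (x - y) * (w y - u_at0 w)))).
Proof.
have ab : (-1 : R) < 0 by rewrite oppr_lt0.
case: dw => -[h1 h2] _ G1 G0.
have [lg wg] := wderivP h1; have [lk wk] := wderivP h2.
have sg := (L2P _ _ _).1 lg; have sk := (L2P _ _ _).1 lk.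
have Ik := sqi_intg (measurable_oo (-1 : R) 0) (mu_itv_lty _ _) sk.
set k := wderiv (-1) 0 (wderiv (-1) 0 w) in lk wk sk Ik.
have bE : {in `]-1, 0[%classic, (fun x => -1 * k x) =1 opB J C1 C2 w}.
  move=> x; rewrite mem_setE in_itv /= => /andP[_ x0].
  by rewrite /opB x0 mulN1r.
split; first exact: (eq_intg (measurable_oo _ _) bE (intgZ (measurable_oo _ _) _ Ik)).
transitivity (\int[mu]_(x in `]-1, 0[) (-1 * k x)).
  by apply: eq_Rintegral => x xI; rewrite -bE.
rewrite RintegralZl//.
by rewrite (flux_balance ab sg sk wk G1) G0 mulN1r.
Qed.

Lemma local_dissipation :
  let q x := w x - u_at0 w in
  [/\ sqi `]-1, 0[ w, intg `]-1, 0[ (fun x => opB J C1 C2 w x * q x) &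
  \int[mu]_(x in `]-1, 0[) q x ^+ 2 <=
    \int[mu]_(x in `]-1, 0[) (opB J C1 C2 w x * q x)].
Proof.
move=> q; have ab : (-1 : R) < 0 by rewrite oppr_lt0.
have mI := measurable_oo (-1 : R) 0; have fI := mu_itv_lty (-1 : R) 0.
case: dw => -[h1 h2] _ G1 _.
have [lg wg] := wderivP h1; have [lk wk] := wderivP h2.
have sg := (L2P _ _ _).1 lg; have sk := (L2P _ _ _).1 lk.
have sw := (L2P _ _ _).1 (proj1 h1).
have sq := sqiB mI sw (sqi_cst mI fI (u_at0 w)).
set k := wderiv (-1) 0 (wderiv (-1) 0 w) in lk wk sk.
have bE : {in `]-1, 0[%classic, (fun x => - k x * q x) =1
    (fun x => opB J C1 C2 w x * q x)}.
  move=> x; rewrite mem_setE in_itv /= => /andP[_ x0].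
  by rewrite /opB x0.
have Ikq := intgZ mI (-1) (sqi_mul mI sk sq).
split=> //; first by apply: (eq_intg mI _ Ikq) => x xI; rewrite -bE// /q; ring.
have -> : \int[mu]_(x in `]-1, 0[) (opB J C1 C2 w x * q x) =
    \int[mu]_(x in `]-1, 0[) (- k x * q x).
  by apply: eq_Rintegral => x xI; rewrite -bE.
rewrite (Dirichlet_energy ab sw sg sk wg wk G1).
by have := trace_poincare ab sw sg wg; rewrite sub0r opprK expr1n mul1r.
Qed.

End local_part.

Section nonlocal_part.
Variable w : R -> R.
Hypothesis sw : sqi `]0, 1[ w.

Let q x := w x - u_at0 w.
Let mI := measurable_oo (0 : R) 1.
Let fI := mu_itv_lty (0 : R) 1.
Let mL := measurable_oo (-1 : R) 0.
Let fL := mu_itv_lty (-1 : R) 0.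
Let sq : sqi `]0, 1[ q.
Proof. by apply: (sqiB mI sw); exact: (sqi_cst mI fI). Qed.
Let Iq : intg `]0, 1[ q. Proof. exact: (sqi_intg mI fI sq). Qed.
Let Iq2 : intg `]0, 1[ (fun x => q x ^+ 2). Proof. by case: sq. Qed.
Let I1 : intg `]-1, 0[ (fun=> 1 : R). Proof. exact: (intg_cst mL fL). Qed.

Let mJ := kernel_measurable hJ.
Let Jsym : forall z, J (- z) = J z. Proof. by case: hJ. Qed.
Let K (z : R * R) : R := J (z.1 - z.2).
Let mK : measurable_fun setT K. Proof. exact: measurable_diff_kernel. Qed.

Let N x := \int[mu]_(y in `]0, 1[) (J (x - y) * (q y - q x)).
Let Kc x := \int[mu]_(y in `]-1, 0[) J (x - y).

Let KcE x : Kc x = \int[mu]_(y in `]-1, 0[) (K (x, y) * 1).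
Proof. by apply: eq_Rintegral => y _; rewrite mulr1. Qed.

Let opBE : {in `]0, 1[%classic, (fun x => - C1 * N x + C2 * (q x * Kc x)) =1
  opB J C1 C2 w}.
Proof.
move=> x; rewrite mem_setE in_itv /= => /andP[x0 _].
rewrite /opB ltNge (ltW x0) /= /N /Kc /q; congr (_ * _ + _).
  by apply: eq_Rintegral => y _; congr (_ * _); ring.
by rewrite -mulrA; congr (_ * _); rewrite mulrC.
Qed.

(** The jumps inside ]0, 1[ balance; the exchange with ]-1, 0[ is the flux
prescribed at 0, by symmetry of J. *)
Lemma nonlocal_mean :
  intg `]0, 1[ (opB J C1 C2 w) /\
  \int[mu]_(x in `]0, 1[) opB J C1 C2 w x =
    C2 * \int[mu]_(x in `]-1, 0[)
              (\int[mu]_(y in `]0, 1[) (J (x - y) * (w y - u_at0 w))).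
Proof.
have [M JM] := kernel_bounded hJ; have hK z : `|K z| <= M by exact: JM.
have iN : intg `]0, 1[ N by exact: (intg_nonlocal mI fI mJ JM sq).
have iK : intg `]0, 1[ (fun x => q x * Kc x).
  have := intg_kernel1 mI mL mK hK Iq I1.
  by apply: (eq_intg mI) => x _; rewrite KcE.
split.
  by apply: (eq_intg mI opBE); apply: (intgD mI); exact: intgZ.
transitivity (\int[mu]_(x in `]0, 1[) (- C1 * N x + C2 * (q x * Kc x))).
  by apply: eq_Rintegral => x xI; rewrite -opBE.
rewrite RintegralD//; [|exact: intgZ..].
rewrite RintegralZl// RintegralZl//.
rewrite /N (nonlocal_mean0 mI fI mJ JM sq Jsym) mulr0 add0r; congr (_ * _).
transitivity (\int[mu]_(x in `]0, 1[) (q x * \int[mu]_(y in `]-1, 0[) (K (x, y) * 1))).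
  by apply: eq_Rintegral => x _; rewrite KcE.
rewrite (kernel_swap mI mL mK hK Iq I1).
apply: eq_Rintegral => x _; rewrite mul1r; apply: eq_Rintegral => y _.
by rewrite /K /= -Jsym opprB.
Qed.

(** Since differences of w and of q agree, B w on ]0, 1[ is the nonlocal
diffusion of q plus multiplication by C2 * Kc. *)
Lemma nonlocal_dissipation l d c : 0 < l -> 0 < d -> l + 2 * d <= 1 -> 0 < c ->
  (forall z, l < z < l + 2 * d -> c <= J z) ->
  intg `]0, 1[ (fun x => opB J C1 C2 w x * q x) /\
  Num.min (C1 / 4) C2 * (d * c / 2 * expR (- (3 / l))) *
      \int[mu]_(x in `]0, 1[) q x ^+ 2 <=
    \int[mu]_(x in `]0, 1[) (opB J C1 C2 w x * q x).
Proof.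
move=> l0 d0 ld1 c0 Jc.
have J0 : forall z, 0 <= J z by case: hJ.
have [M JM] := kernel_bounded hJ; have hK z : `|K z| <= M by exact: JM.
have := nonlocal_coercive l0 d0 ld1 c0 Jc J0 mJ JM sq.
have iN : intg `]0, 1[ (fun x => q x * N x).
  exact: (intg_mul_nonlocal mI fI mJ JM sq).
have iK : intg `]0, 1[ (fun x => Kc x * q x ^+ 2).
  have := intg_kernel1 mI mL mK hK Iq2 I1.
  by apply: (eq_intg mI) => x _; rewrite KcE mulrC.
have bqE : {in `]0, 1[%classic,
    (fun x => - C1 * (q x * N x) + C2 * (Kc x * q x ^+ 2)) =1
    (fun x => opB J C1 C2 w x * q x)}.
  by move=> x xI; rewrite -opBE//; ring.
have aux (E Q S s : R) : 0 <= E -> 0 <= Q -> s * S <= 2 * E + Q ->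
    Num.min (C1 / 4) C2 * s * S <= - C1 * (- 2^-1 * E) + C2 * Q.
  move=> E0 Q0 sS; have [C1' C2'] := (hC1, hC2).
  set n := Num.min _ _; have n0 : 0 <= n by rewrite le_min !ltW// divr_gt0.
  have n1 : n <= C1 / 4 by rewrite ge_min lexx.
  have n2 : n <= C2 by rewrite ge_min lexx orbT.
  rewrite -mulrA (le_trans (ler_wpM2l n0 sS))// mulrDr lerD ?ler_wpM2r//.
  by have := ler_wpM2r E0 n1; lra.
move=> coer; split.
  by apply: (eq_intg mI bqE); apply: (intgD mI); exact: intgZ.
have -> : \int[mu]_(x in `]0, 1[) (opB J C1 C2 w x * q x) =
    \int[mu]_(x in `]0, 1[) (- C1 * (q x * N x) + C2 * (Kc x * q x ^+ 2)).
  by apply: eq_Rintegral => x xI; rewrite -bqE.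
rewrite RintegralD//; [|exact: intgZ..].
rewrite RintegralZl// RintegralZl// (nonlocal_energy mI fI mJ JM sq Jsym).
apply: aux coer.
  by apply: Rintegral_ge0 => x _; apply: Rintegral_ge0 => y _; rewrite mulr_ge0 ?sqr_ge0.
by apply: Rintegral_ge0 => x _; rewrite mulr_ge0 ?sqr_ge0 ?Rintegral_ge0.
Qed.

End nonlocal_part.
End dissipation.

(** * Contraction by one resolvent step *)

Section gluing.
Variable R : realType.
Local Notation mu := (@leb R).

Lemma intgU (D E : set R) (f : R -> R) :
  @measurable _ (measurableTypeR R) D -> @measurable _ (measurableTypeR R) E ->
  [disjoint D & E] -> intg D f -> intg E f -> intg (D `|` E) f.
Proof.
move=> mD mE DE If Ig.
have mf : measurable_fun (D `|` E) f.
  by apply/measurable_funU => //; split; exact: intg_meas.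
apply/integrableP; split; first exact/measurable_EFinP.
rewrite ge0_integral_setU//; last by apply: measurableT_comp => //; exact/measurable_EFinP.
by rewrite lte_add_pinfty//; [case/integrableP: If|case/integrableP: Ig].
Qed.

Variables (a c b : R).
Hypotheses (ac : a < c) (cb : c < b).

Let itv_split : `]a, b[%classic = (`]a, c[ `|` [set c]) `|` `]c, b[ :> set R.
Proof.
have [ac' cb'] := (ac, cb).
apply/seteqP; split=> x /=; rewrite !in_itv /=.
  move=> /andP[ax xb]; have [xc|xc|->] := ltgtP x c.
  - by left; left; rewrite ax.
  - by right; rewrite xb.
  - by left; right.
move=> [[/andP[ax xc]|->]|/andP[cx xb]]; apply/andP; split; lra.
Qed.

Lemma measurable_fun_glue (f : R -> R) : measurable_fun `]a, c[ f ->
  measurable_fun `]c, b[ f -> measurable_fun `]a, b[ f.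
Proof.
move=> m1 m2; rewrite itv_split; apply/measurable_funU => //.
  by apply: measurableU => //; exact: measurable_set1.
split=> //; apply/measurable_funU => //; split=> //; exact: measurable_fun_set1.
Qed.

Lemma intg_glue (f : R -> R) : intg `]a, c[ f -> intg `]c, b[ f -> intg `]a, b[ f.
Proof.
move=> i1 i2; have m1 := measurable_oo a c; have m2 := measurable_oo c b.
have mc : @measurable _ (measurableTypeR R) [set c] by exact: measurable_set1.
have ic : intg [set c] f.
  apply: null_set_integrable => //.
    exact/measurable_EFinP/measurable_fun_set1.
  exact: lebesgue_measure_set1.
rewrite itv_split; apply: intgU => //; first exact: measurableU.
  apply/disj_setPS => x [[|->]] /=; rewrite !in_itv /= ?ltxx//.
  by move=> /andP[_ xc] /andP[cx _]; have := lt_trans xc cx; rewrite ltxx.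
apply: intgU => //; apply/disj_setPS => x [/=]; rewrite in_itv /=.
by move=> /andP[_ xc] xE; rewrite xE ltxx in xc.
Qed.

Lemma sqi_glue (f : R -> R) : sqi `]a, c[ f -> sqi `]c, b[ f -> sqi `]a, b[ f.
Proof.
move=> [m1 i1] [m2 i2]; split; first exact: measurable_fun_glue.
exact: intg_glue.
Qed.

Lemma Rintegral_split (f : R -> R) : intg `]a, b[ f ->
  \int[mu]_(x in `]a, b[) f x =
  \int[mu]_(x in `]a, c[) f x + \int[mu]_(x in `]c, b[) f x.
Proof.
move=> i; have sub : `]a, c[ `<=` `]a, b[ by apply: itv_oo_sub => //; exact: ltW.
rewrite (Rintegral_itv_bndo_bndc (intgS (measurable_oo a b) (measurable_oo a c) sub i)).
have <- : \int[mu]_(x in `]a, b[) f x - \int[mu]_(x in `]a, c]) f x =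
    \int[mu]_(x in `]c, b[) f x.
  by apply: (Rintegral_itvB i); rewrite bnd_simp// ltW.
by rewrite addrC subrK.
Qed.

End gluing.

Section mean_deviation.
Variable R : realType.
Local Notation mu := (@leb R).
Let I := (`]-1, 1[%classic : set R).
Let mI : @measurable _ (measurableTypeR R) I. Proof. exact: measurable_oo. Qed.
Let fI : (mu I < +oo)%E. Proof. exact: mu_itv_lty. Qed.
Implicit Types f g : R -> R.

Lemma Rintegral_mul_shift f g (s t : R) : sqi `]-1, 1[ f -> sqi `]-1, 1[ g ->
  \int[mu]_(x in `]-1, 1[) ((f x - s) * (g x - t)) =
  \int[mu]_(x in `]-1, 1[) (f x * g x) - t * \int[mu]_(x in `]-1, 1[) f x
  - s * \int[mu]_(x in `]-1, 1[) g x + 2 * s * t.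
Proof.
move=> sf sg; have If := sqi_intg mI fI sf; have Ig := sqi_intg mI fI sg.
have Ifg := sqi_mul mI sf sg.
have Ist := intg_cst mI fI (s * t).
rewrite -RintegralZl// -[s * _]RintegralZl// -RintegralB//; last exact: intgZ.
rewrite -RintegralB//; [|by apply: (intgB mI) => //; exact: intgZ|exact: intgZ].
rewrite (_ : 2 * s * t = \int[mu]_(x in I) (s * t)); last first.
  by rewrite Rintegral_itv_cst ?opprK; [ring|lra].
rewrite -RintegralD//; last first.
  by apply: (intgB mI); [apply: (intgB mI)|] => //; exact: intgZ.
by apply: eq_Rintegral => x _; ring.
Qed.

(** The interval ]-1, 1[ has length 2. *)
Definition mean f : R := 1 / 2 * \int[mu]_(x in `]-1, 1[) f x.

Definition dispersion f : R := \int[mu]_(x in `]-1, 1[) (f x - mean f) ^+ 2.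

Lemma dispersion_ge0 f : 0 <= dispersion f.
Proof. by apply: Rintegral_ge0 => x _; exact: sqr_ge0. Qed.

Lemma dispersionE f : sqi `]-1, 1[ f ->
  dispersion f = \int[mu]_(x in `]-1, 1[) (f x * f x) -
    (\int[mu]_(x in `]-1, 1[) f x) ^+ 2 / 2.
Proof.
move=> sf; rewrite /dispersion; under eq_Rintegral do rewrite expr2.
by rewrite Rintegral_mul_shift// /mean; field.
Qed.

(** Writing r = 1 + h * beta, m for the common mean, V(f) for the dispersion
and C for int (y - m) (f - m), the hypothesis gives r * V(f) <= C, as V(f) is
at most int (f - c)^2. Together with V(y - r f) = V(y) - 2 r C + r^2 V(f) >= 0
this yields r^2 * V(f) <= V(y). *)
Lemma resolvent_contraction f y (h beta c : R) : 0 < h -> 0 <= beta ->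
  sqi `]-1, 1[ f -> sqi `]-1, 1[ y ->
  \int[mu]_(x in `]-1, 1[) (y x - f x) = 0 ->
  h * beta * \int[mu]_(x in `]-1, 1[) (f x - c) ^+ 2 <=
    \int[mu]_(x in `]-1, 1[) ((y x - f x) * (f x - c)) ->
  (1 + h * beta) ^+ 2 * dispersion f <= dispersion y.
Proof.
move=> h0 b0 sf sy yf0.
have If := sqi_intg mI fI sf; have Iy := sqi_intg mI fI sy.
have f1 : \int[mu]_(x in `]-1, 1[) y x = \int[mu]_(x in `]-1, 1[) f x.
  by apply/eqP; rewrite -subr_eq0 -RintegralB//; apply/eqP.
pose r := 1 + h * beta.
have sd := sqiB mI sy (sqiZ mI r sf).
have pos : 0 <= \int[mu]_(x in `]-1, 1[)
    ((y x - r * f x - (1 - r) * mean f) * (y x - r * f x - (1 - r) * mean f)).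
  by apply: Rintegral_ge0 => x _; rewrite -expr2 sqr_ge0.
have yf := sqi_mul mI sy sf; have ff := sqi_mul mI sf sf; have yy := sqi_mul mI sy sy.
have E1 : \int[mu]_(x in `]-1, 1[) (y x - r * f x) = (1 - r) * \int[mu]_(x in `]-1, 1[) f x.
  by rewrite RintegralB//; [rewrite RintegralZl// f1; ring|exact: intgZ].
have E2 : \int[mu]_(x in `]-1, 1[) ((y x - r * f x) * (y x - r * f x)) =
    \int[mu]_(x in `]-1, 1[) (y x * y x) - 2 * r * \int[mu]_(x in `]-1, 1[) (y x * f x)
    + r ^+ 2 * \int[mu]_(x in `]-1, 1[) (f x * f x).
  rewrite -RintegralZl// -[r ^+ 2 * _]RintegralZl// -RintegralB//; last exact: intgZ.
  rewrite -RintegralD//; [|by apply: (intgB mI) => //; exact: intgZ|exact: intgZ].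
  by apply: eq_Rintegral => x _; ring.
have E3 : \int[mu]_(x in `]-1, 1[) ((y x - f x) * (f x - c)) =
    \int[mu]_(x in `]-1, 1[) (y x * f x) - \int[mu]_(x in `]-1, 1[) (f x * f x).
  under eq_Rintegral do rewrite -[y _ - f _]subr0.
  rewrite Rintegral_mul_shift//; last exact: (sqiB mI).
  rewrite yf0 mulr0 mul0r !subr0 mulr0 mul0r addr0 -RintegralB//.
  by apply: eq_Rintegral => x _; ring.
have E4 : \int[mu]_(x in `]-1, 1[) (f x - c) ^+ 2 =
    \int[mu]_(x in `]-1, 1[) (f x * f x) - 2 * c * \int[mu]_(x in `]-1, 1[) f x
    + 2 * c ^+ 2.
  under eq_Rintegral do rewrite expr2.
  by rewrite Rintegral_mul_shift//; ring.
rewrite Rintegral_mul_shift// E1 E2 /mean in pos.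
rewrite E3 E4 !dispersionE// f1.
move: pos; rewrite -/r.
move: (\int[mu]_(x in _) f x) (\int[mu]_(x in _) (y x * y x))
  (\int[mu]_(x in _) (f x * f x)) (\int[mu]_(x in _) (y x * f x)) => F YY FF YF.
clear - h0 b0 r.
have r1 : r = 1 + h * beta by [].
have hb : 0 <= h * beta by rewrite mulr_ge0// ltW.
move: r1 hb; move: r (h * beta) => r k -> k0 pos coer.
have c2 : FF - F ^+ 2 / 2 <= FF - 2 * c * F + 2 * c ^+ 2.
  rewrite -subr_ge0 (_ : _ - _ = (F - 2 * c) ^+ 2 / 2); last by field.
  by rewrite divr_ge0 ?sqr_ge0.
have c3 : k * (FF - F ^+ 2 / 2) <= YF - FF by rewrite (le_trans (ler_wpM2l k0 c2)).
have c4 : 0 <= 2 * (1 + k) * (YF - FF - k * (FF - F ^+ 2 / 2)).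
  by rewrite mulr_ge0 ?subr_ge0// mulr_ge0// addr_ge0.
rewrite -subr_ge0; move: pos c4.
set p := (X in 0 <= X -> _); set q := (X in 0 <= X -> 0 <= _) => p0 q0.
rewrite (_ : _ - _ = p + q); first exact: addr_ge0.
by rewrite /p /q; field.
Qed.

End mean_deviation.

(** * Decay of Euler approximations and of mild solutions *)

Section euler.
Variables (R : realType) (J : R -> R) (C1 C2 : R).
Hypotheses (hJ : admissible_kernel J) (hC1 : 0 < C1) (hC2 : 0 < C2).
Local Notation mu := (@leb R).

(** One step of [euler_approximation] from y to w. *)
Definition euler_step (w y : R -> R) (h : R) : Prop :=
  domB J C2 w /\
  (fun x => (w x - y x) / h + opB J C1 C2 w x) = (fun=> 0)
    %[ae mu in `]-1, 1[%classic].

(** The two fluxes through the interface cancel and the two dissipation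
inequalities add up. *)
Lemma dissipation_rate : exists2 beta : R, 0 < beta &
  forall w, domB J C2 w ->
  [/\ sqi `]-1, 1[ w, intg `]-1, 1[ (opB J C1 C2 w),
      intg `]-1, 1[ (fun x => opB J C1 C2 w x * (w x - u_at0 w)),
      \int[mu]_(x in `]-1, 1[) opB J C1 C2 w x = 0 &
      beta * \int[mu]_(x in `]-1, 1[) (w x - u_at0 w) ^+ 2 <=
        \int[mu]_(x in `]-1, 1[) (opB J C1 C2 w x * (w x - u_at0 w))].
Proof.
have [l [d [c [l0 d0 ld1 c0 Jc]]]] := kernel_pos_itv hJ.
set b2 := Num.min (C1 / 4) C2 * (d * c / 2 * expR (- (3 / l))).
have b20 : 0 < b2.
  by rewrite mulr_gt0 ?lt_min ?divr_gt0 ?hC2// mulr_gt0 ?expR_gt0// divr_gt0 ?mulr_gt0.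
exists (Num.min 1 b2); first by rewrite lt_min ltr01.
move=> w dw; have [_ lw _ _] := dw.
have sw1 := (L2P _ _ _).1 lw.
have [sw0 i0 d0'] := local_dissipation C1 dw.
have [ib0 m0] := local_mean C1 dw.
have [ib1 m1] := nonlocal_mean C1 C2 hJ sw1.
have [i1 d1'] := nonlocal_dissipation hJ hC1 hC2 sw1 l0 d0 ld1 c0 Jc.
have ltN : (-1 : R) < 0 by rewrite oppr_lt0.
have sw := sqi_glue ltN ltr01 sw0 sw1.
have ib := intg_glue ltN ltr01 ib0 ib1.
have i := intg_glue ltN ltr01 i0 i1.
split=> //; first by rewrite (Rintegral_split ltN ltr01 ib) m0 m1 addNr.
have [_ iq] := sqiB (measurable_oo _ _) sw (sqi_cst (measurable_oo _ _) (mu_itv_lty (-1 : R) 1) (u_at0 w)).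
rewrite (Rintegral_split ltN ltr01 i) (Rintegral_split ltN ltr01 iq) mulrDr.
have int0 (A : set R) : 0 <= \int[mu]_(x in A) (w x - u_at0 w) ^+ 2.
  by apply: Rintegral_ge0 => x _; exact: sqr_ge0.
apply: lerD.
  by apply: le_trans d0'; rewrite ler_piMl// ge_min lexx.
by apply: le_trans d1'; rewrite ler_wpM2r// ge_min lexx orbT.
Qed.

(** The step says that h * B w = y - w almost everywhere, so that conservation
of the mean and the bound on B become the hypotheses of the abstract
contraction. *)
Lemma euler_step_contraction : exists2 beta : R, 0 < beta &
  forall w y h, 0 < h -> sqi `]-1, 1[ y -> euler_step w y h ->
  [/\ sqi `]-1, 1[ w,
      \int[mu]_(x in `]-1, 1[) w x = \int[mu]_(x in `]-1, 1[) y x &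
      (1 + h * beta) ^+ 2 * dispersion w <= dispersion y].
Proof.
have [beta b0 diss] := dissipation_rate; exists beta => // w y h h0 sy [dw weq].
have [sw ib ibq mb dq] := diss w dw.
have mI := measurable_oo (-1 : R) 1; have fI := mu_itv_lty (-1 : R) 1.
have sr := sqiB mI sy sw.
have sq := sqiB mI sw (sqi_cst mI fI (u_at0 w)).
have Ir := sqi_intg mI fI sr.
have bE : opB J C1 C2 w = (fun x => h^-1 * (y x - w x)) %[ae mu in `]-1, 1[%classic].
  apply: ae_mono weq => x wx xI; have := wx xI.
  move/eqP; rewrite addrC addr_eq0 => /eqP ->.
  by rewrite -mulNr opprB mulrC.
have mean0 : \int[mu]_(x in `]-1, 1[) (y x - w x) = 0.
  have : h^-1 * \int[mu]_(x in `]-1, 1[) (y x - w x) = 0.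
    rewrite -RintegralZl// -mb; apply: ae_eq_Rintegral => //.
    - exact: intg_meas (intgZ mI _ Ir).
    - exact: intg_meas ib.
    - by apply: ae_mono bE => x bx xI; rewrite (bx xI).
  by move/eqP; rewrite mulf_eq0 invr_eq0 gt_eqF//= => /eqP.
have Irq := sqi_mul mI sr sq.
split=> //.
  have Iy := sqi_intg mI fI sy; have Iw := sqi_intg mI fI sw.
  by apply/esym/eqP; rewrite -subr_eq0 -RintegralB//; apply/eqP.
apply: (resolvent_contraction (c := u_at0 w) h0 (ltW b0) sw sy mean0).
rewrite -mulrA -ler_pdivlMl// -[leRHS]RintegralZl//.
apply: (le_trans dq); rewrite le_eqVlt; apply/orP; left; apply/eqP.
apply: ae_eq_Rintegral => //.
- exact: intg_meas ibq.
- exact: intg_meas (intgZ mI _ Irq).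
by apply: ae_mono bE => x bx xI; rewrite (bx xI) mulrA.
Qed.

End euler.

Section norms.
Variable R : realType.
Local Notation mu := (@leb R).

(** exp(-x / 2) >= 1 - x / 2, and (1 - x / 2) (1 + x) >= 1 for 0 <= x <= 1. *)
Lemma expR_le_sqr (x : R) : 0 <= x <= 1 -> expR x <= (1 + x) ^+ 2.
Proof.
move=> /andP[x0 x1]; have half : expR (x / 2) <= 1 + x.
  have h : 1 - x / 2 <= expR (- (x / 2)) by rewrite (le_trans _ (expR_ge1Dx _))//.
  have p : 0 < 1 - x / 2 by lra.
  rewrite -[expR _]invrK -expRN.
  apply: (@le_trans _ _ (1 - x / 2)^-1); first by rewrite lef_pV2 ?posrE ?expR_gt0.
  by rewrite -[_^-1]mul1r ler_pdivrMr//; nra.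
rewrite (_ : expR x = expR (x / 2) ^+ 2); first by rewrite lerXn2r ?nnegrE ?expR_ge0 ?addr_ge0.
by rewrite expr2 -expRD -splitr.
Qed.

Definition norm2 (f : R -> R) : R := Num.sqrt (\int[mu]_(x in `]-1, 1[) f x ^+ 2).

Lemma norm2_triangle (f g : R -> R) : sqi `]-1, 1[ f -> sqi `]-1, 1[ g ->
  norm2 (fun x => f x + g x) <= norm2 f + norm2 g.
Proof.
move=> sf sg; have mI := measurable_oo (-1 : R) 1.
rewrite -lee_fin EFinD -!L2normE//; last exact: sqiD.
have mr (h : R -> R) : sqi `]-1, 1[ h -> measurable_fun setT (h \_ `]-1, 1[).
  by move=> [mh _]; exact/(measurable_restrictT _ mI).
have := @eminkowski _ _ _ mu (f \_ `]-1, 1[) (g \_ `]-1, 1[) 2%:E (mr _ sf) (mr _ sg).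
rewrite lee1n => /(_ isT); apply: le_trans; rewrite /L2norm.
rewrite le_eqVlt; apply/orP; left; apply/eqP; apply: eq_Lnorm => x /=.
by rewrite !patchE; case: ifP => //; rewrite addr0.
Qed.

Lemma norm2_sub_mean (f : R -> R) : norm2 (fun x => f x - mean f) = Num.sqrt (dispersion f).
Proof. by []. Qed.

(** The mean is the orthogonal projection on the constants. *)
Lemma norm2_mean_le (f : R -> R) : sqi `]-1, 1[ f -> norm2 (fun=> mean f) <= norm2 f.
Proof.
move=> sf; rewrite ler_wsqrtr//.
have := dispersion_ge0 f; rewrite dispersionE//.
rewrite Rintegral_itv_cst; last lra.
under [X in _ -> _ <= X]eq_Rintegral do rewrite expr2.
by rewrite /mean opprK; move: (\int[mu]_(x in _) f x) => F; lra.
Qed.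

Lemma norm2_le_L2norm (f : R -> R) (e : R) : sqi `]-1, 1[ f ->
  (L2norm (-1) 1 f <= e%:E)%E -> norm2 f <= e.
Proof. by move=> sf; rewrite L2normE// lee_fin. Qed.

End norms.

(** The bound on delta keeps every step in the range where
exp(beta h) <= (1 + beta h)^2. *)
Lemma euler_decay (R : realType) (J : R -> R) (C1 C2 : R) :
  admissible_kernel J -> 0 < C1 -> 0 < C2 ->
  exists2 beta : R, 0 < beta &
  forall (w0 : R -> R) (w : R -> R -> R) (T delta : R) N t z,
    sqi `]-1, 1[ w0 -> delta * beta <= 1 ->
    euler_approximation J C1 C2 w0 w T delta N t z ->
    forall i, (i <= N)%N -> [/\ sqi `]-1, 1[ (z i), mean (z i) = mean (z 0%N) &
      dispersion (z i) <= dispersion (z 0%N) * expR (- (beta * t i))].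
Proof.
move=> hJ hC1 hC2; have [beta b0 step] := euler_step_contraction hJ hC1 hC2.
exists beta => // w0 w T delta N t z sw0 db [[t0 tN] dt [lz0 _] dz _].
elim=> [_|i IH iN].
  by split=> //; [exact/L2P|rewrite t0 mulr0 oppr0 expR0 mulr1].
have [szi mi vi] := IH (ltnW iN).
have [tlt tle] := dt i iN.
have h0 : 0 < t i.+1 - t i by rewrite subr_gt0.
have [sz im vz] := step _ _ _ h0 szi (dz i iN).
split=> //; first by rewrite /mean im; exact: mi.
set h := t i.+1 - t i in h0 tle vz.
have hb0 : 0 <= h * beta by rewrite mulr_ge0 ?ltW.
have hb1 : h * beta <= 1 by apply: le_trans db; rewrite ler_wpM2r// ltW.
have eh : expR (h * beta) <= (1 + h * beta) ^+ 2 by apply: expR_le_sqr; rewrite hb0.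
have : expR (h * beta) * dispersion (z i.+1) <= dispersion (z 0%N) * expR (- (beta * t i)).
  apply: le_trans vi; apply: le_trans vz.
  by rewrite ler_wpM2r// dispersion_ge0.
rewrite mulrC -ler_pdivlMr ?expR_gt0// -expRN -mulrA -expRD.
by move/le_trans; apply; rewrite (_ : _ + _ = - (beta * t i.+1))//; rewrite /h; ring.
Qed.

Theorem theorem1p2 (R : realType) (C1 C2 : R) (hC1 : 0 < C1) (hC2 : 0 < C2)
    (J : R -> R) (hJ : admissible_kernel J) :
  exists2 beta1 : R, 0 < beta1 &
    forall w0 : R -> R, L2 (-1) 1 w0 ->
    exists C : R, forall w : R -> R -> R, mild_solution J C1 C2 w0 w ->
      forall t : R, 0 < t ->
        (L2norm (-1) 1
           (fun x => w t x - 1 / 2 * \int[@lebesgue_measure R]_(y in `]-1, 1[) w0 y)%R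
         <= (C * expR (- (beta1 * t)))%:E)%E.
Proof.
have [beta b0 decay] := euler_decay hJ hC1 hC2.
exists (beta / 2); first by rewrite divr_gt0.
move=> w0 lw0; have sw0 := (L2P _ _ _).1 lw0.
exists (norm2 (fun x => w0 x - mean w0)) => w [lw _ _ app] T T0.
have mI := measurable_oo (-1 : R) 1; have fI := mu_itv_lty (-1 : R) 1.
have swT := (L2P _ _ _).1 (lw T (ltW T0)).
have sc (c : R) := sqi_cst mI fI c.
rewrite -/(mean w0) L2normE; last exact: sqiB.
rewrite lee_fin -/(norm2 _); apply/ler_addgt0Pr => e e0.
(* The error delta enters four times: in w T and z N, in the means, and twice
   in the distance of z 0 to its mean. *)
pose delta := Num.min (e / 4) beta^-1.
have de : 4 * delta <= e.
  by rewrite mulrC -ler_pdivlMr// ge_min lexx.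
have db : delta * beta <= 1 by rewrite -ler_pdivlMr// div1r ge_min lexx orbT.
have delta0 : 0 < delta by rewrite lt_min divr_gt0// invr_gt0.
have [N [t [z ea]]] := app T delta T0 delta0.
have [[t0 tN] _ [lz0 z0w0] _ zw] := ea.
have [szN mN vN] := decay w0 w T delta N t z sw0 db ea N (leqnn N).
have sz0 := (L2P _ _ _).1 lz0.
have N0 : (0 < N)%N.
  by rewrite lt0n; apply/eqP => N0; move: T0; rewrite -tN N0 t0 ltxx.
have wz : norm2 (fun x => w T x - z N x) <= delta.
  apply: norm2_le_L2norm; first exact: sqiB.
  have := zw N.-1 T; rewrite prednK// leqnn => /(_ isT); apply.
  have [_ dt _ _ _] := ea; have := dt N.-1; rewrite prednK// leqnn => /(_ isT)[tl _].
  by rewrite -tN tl lexx.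
have zd : norm2 (fun x => z 0%N x - w0 x) <= delta by apply: norm2_le_L2norm => //; exact: sqiB.
have mz : mean (fun x => z 0%N x - w0 x) = mean (z 0%N) - mean w0.
  by rewrite /mean RintegralB ?mulrBr//; exact: sqi_intg.
have md : norm2 (fun=> mean (z 0%N) - mean w0) <= delta.
  by rewrite -mz; apply: le_trans zd; apply: norm2_mean_le; exact: sqiB.
have md' : norm2 (fun=> mean w0 - mean (z 0%N)) <= delta.
  apply: le_trans md; rewrite /norm2.
  by under eq_Rintegral do rewrite -sqrrN opprB.
set A := norm2 (fun x => w0 x - mean w0).
have v0 : Num.sqrt (dispersion (z 0%N)) <= A + 2 * delta.
  rewrite -norm2_sub_mean.
  have t1 := norm2_triangle (sqiB mI sz0 sw0)
    (sqiD mI (sqiB mI sw0 (sc (mean w0))) (sc (mean w0 - mean (z 0%N)))).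
  have t2 := norm2_triangle (sqiB mI sw0 (sc (mean w0))) (sc (mean w0 - mean (z 0%N))).
  have -> : (fun x => z 0%N x - mean (z 0%N)) = (fun x => (z 0%N x - w0 x) +
      ((w0 x - mean w0) + (mean w0 - mean (z 0%N)))).
    by apply/funext => x; ring.
  move: t1 t2 zd md'; rewrite -/A.
  move: (norm2 _) (norm2 _) (norm2 _) (norm2 _) => p1 p2 p3 p4; clear; lra.
have vNs : Num.sqrt (dispersion (z N)) <= A * expR (- (beta / 2 * T)) + 2 * delta.
  rewrite tN in vN; apply: (le_trans (ler_wsqrtr vN)).
  rewrite sqrtrM ?dispersion_ge0//.
  have -> : Num.sqrt (expR (- (beta * T))) = expR (- (beta / 2 * T)).
    rewrite (_ : - (beta * T) = - (beta / 2 * T) + - (beta / 2 * T)); last by field.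
    by rewrite expRD -expr2 sqrtr_sqr ger0_norm ?expR_ge0.
  have E1 : expR (- (beta / 2 * T)) <= 1.
    by rewrite -expR0 ler_expR oppr_le0 mulr_ge0 ?divr_ge0 ?ltW.
  apply: (le_trans (ler_wpM2r (expR_ge0 _) v0)); rewrite mulrDl lerD2l.
  by rewrite ler_piMr// mulr_ge0// ltW.
have t1 := norm2_triangle (sqiB mI swT szN)
  (sqiD mI (sqiB mI szN (sc (mean (z N)))) (sc (mean (z N) - mean w0))).
have t2 := norm2_triangle (sqiB mI szN (sc (mean (z N)))) (sc (mean (z N) - mean w0)).
have -> : (fun x => w T x - mean w0) = (fun x => (w T x - z N x) +
    ((z N x - mean (z N)) + (mean (z N) - mean w0))).
  by apply/funext => x; ring.
rewrite norm2_sub_mean in t2; rewrite -mN in md.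
move: t1 t2 wz md vNs de; rewrite -/A.
move: (norm2 _) (norm2 _) (norm2 _) (norm2 _) (Num.sqrt _) (A * _) => p1 p2 p3 p4 p5 p6.
clear; lra.
Qed.
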